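(* In the multi-agent setting described in the context (differentiable convex functions $f_i$, closed convex sets $H_i$, nonnegative weight matrices $\mathcal{A}(k)=[a_{ij}(k)]$ with associated graphs $\mathcal{G}(k)$, and the discrete-time algorithm given there with sample time $T>0$), suppose that the following hold: (i) for each $i\in\mathcal{I}$, the set $X_i=\{x\in\mathbb{R}^r\mid \nabla f_i(x)=0\}$ is nonempty and bounded; (ii) $H=\bigcap_{i=1}^n H_i\neq\emptyset$; (iii) there is a constant $0<\eta\le 1$ such that for all $k\ge 0$ and all $i,j\in\mathcal{I}$: $a_{ii}(k)\ge\eta$, each nonzero $a_{ij}(k)$ satisfies $a_{ij}(k)\ge\eta$, and $\mathcal{A}(k)$ is doubly stochastic, i.e. $\sum_{i=1}^n a_{ij}(k)=1$ for every $j$ and $\sum_{j=1}^n a_{ij}(k)=1$ for every $i$; (iv) there exist a positive integer $M$ and an infinite sequence $k_0,k_1,k_2,\ldots$ of switching times of the graph $\mathcal{G}(k)$ such that $k_0=0$, $0<k_{j+1}-k_j\le M$, and the union of all the graphs during each interval $[k_j,k_{j+1})$ is strongly connected, for all integers $j\ge 0$. If $\gamma_i=1$ for all $i\in\mathcal{I}$, then for arbitrary initial conditions $x_i(0)\in H_i$ and $q_i(0)>0$, all agents reach a consensus, i.e., $\lim_{k\to+\infty}[x_i(k)-x^*(k)]=0$ for all $i\in\mathcal{I}$, where $x^*(k)=\frac1n\sum_{i=1}^n x_i(k)$, and they minimize the team objective function as $k\to+\infty$, i.e., $\lim_{k\to+\infty}\|x_i(k)-P_{\mathcal{X}}(x^*(k))\|=0$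 for all $i\in\mathcal{I}$, where $\mathcal{X}$ is the set of minimizers of $\sum_{i=1}^n f_i(s)$ over $s\in H$, while each agent remains in its corresponding constraint set, i.e., $x_i(k)\in H_i$ for all $i\in\mathcal{I}$ and all $k\ge 0$.
   Context: Let $\mathcal{I}=\{1,\ldots,n\}$ index $n$ agents. For each $i\in\mathcal{I}$, $f_i:\mathbb{R}^r\to\mathbb{R}$ is a differentiable convex function and $H_i\subseteq\mathbb{R}^r$ is a closed convex set. $\|\cdot\|$ is the Euclidean norm, and for a nonempty closed convex set $K$, $P_K(s)=\arg\min_{\bar s\in K}\|s-\bar s\|$ is the Euclidean projection onto $K$. The optimization problem is: minimize $\sum_{i=1}^n f_i(s)$ subject to $s\in H=\bigcap_{i=1}^n H_i$ (equivalently, minimize $\sum_{i=1}^n f_i(x_i)$ subject to $x_i=x_j\in H$ for all $i,j$). Its optimal set is denoted $\mathcal{X}$; under hypotheses (i) and (ii) of the claim, $\mathcal{X}$ is known to be a nonempty closed bounded convex set. Graphs. For each integer $k\ge 0$, $\mathcal{A}(k)=[a_{ij}(k)]\in\mathbb{R}^{n\times n}$ is a matrix with nonnegative entries. $\mathcal{G}(k)$ is the directed graph on $\mathcal{I}$ in which, for $i\ne j$, $(j,i)$ is an edge if and only if $a_{ij}(k)>0$; the neighbor set of agent $i$ is $N_i(k)=\{j\in\mathcal{I}\mid j\neq i,\ a_{ij}(k)>0\}$. A graph is strongly connected if there is a directed path from every agent to every other agent. The union of a family of graphs is the graph on $\mathcal{I}$ whose edge set is the union of their edge sets. Algorithm.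 Let $T>0$ be the sample time and $0<\gamma_i\le 1$ a constant for each $i$; the time argument $k$ stands for $kT$. For all $i\in\mathcal{I}$ and integers $k\ge 0$, $x_i(k+1)=u_i(k)\in\mathbb{R}^r$, where $$q_i(k+1)=q_i(k)+\arctan\big(e^{\|x_i(k)\|}\big)T,\quad q_i(0)>0,$$ $$u_i(k)=(1-\gamma_i)w_i(k)+\gamma_i P_{H_i}[w_i(k)],\qquad w_i(k)=v_i(k)-gr_i(k)T,\qquad v_i(k)=\sum_{j\in N_i(k)\cup\{i\}}a_{ij}(k)x_j(k),$$ $$gr_i(k)=\begin{cases}0, & \text{if } \sqrt{q_i(k)}\le\|\nabla f_i(v_i(k))\|^2,\\[2pt] \dfrac{\nabla f_i(v_i(k))}{\sqrt{q_i(k)}}, & \text{otherwise.}\end{cases}$$ *)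

(* Defs.v *)
From mathcomp Require Import all_boot all_order all_algebra.
From mathcomp Require Import all_classical all_reals all_analysis.

Set Implicit Arguments.
Unset Strict Implicit.
Unset Printing Implicit Defensive.

Import Order.TTheory GRing.Theory Num.Theory.
Import numFieldNormedType.Exports.

Local Open Scope classical_set_scope.
Local Open Scope ring_scope.

(* The library norm [`|x|] on ['rV[R]_r] is the sup norm, hence this separate
   definition.  The topology, [closed], [bounded_set], [differentiable] and
   [-->] are the library ones: they do not depend on the choice of norm. *)
Definition enorm (R : realType) (r : nat) (x : 'rV[R]_r) : R :=
  Num.sqrt (\sum_(j < r) x 0 j ^+ 2).

(* The vector of partial derivatives: it is the gradient where [f] is
   differentiable. *)
Definition grad (R : realType) (r : nat) (f : 'rV[R]_r -> R) (x : 'rV[R]_r) :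
  'rV[R]_r := \row_(j < r) 'D_(delta_mx 0 j) f x.

Definition minimizers (R : realType) (r : nat) (g : 'rV[R]_r -> R)
    (K : set 'rV[R]_r) : set 'rV[R]_r :=
  [set s | K s /\ forall t, K t -> g s <= g t].

(* For [K] nonempty, closed and convex the minimizer exists and is unique;
   otherwise [xget] falls back on [0] or on some minimizer. *)
Definition eproj (R : realType) (r : nat) (K : set 'rV[R]_r) (s : 'rV[R]_r) :
  'rV[R]_r := xget 0 (minimizers (fun t => enorm (s - t)) K).

Definition optimal_set (R : realType) (n r : nat) (f : 'I_n -> 'rV[R]_r -> R)
    (H : 'I_n -> set 'rV[R]_r) : set 'rV[R]_r :=
  minimizers (fun s => \sum_(i < n) f i s) (\bigcap_(i in [set: 'I_n]) H i).

Definition neighbors (R : realType) (n : nat) (A : 'M[R]_n) (i : 'I_n) :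
  {set 'I_n} := [set j | (j != i) && (0 < A i j)]%SET.

(* [edge A j i] is the arc from [j] to [i]: agent [i] receives from [j]. *)
Definition edge (R : realType) (n : nat) (A : 'M[R]_n) : rel 'I_n :=
  fun j i => j \in neighbors A i.

Definition union_edge (R : realType) (n : nat) (A : nat -> 'M[R]_n)
    (a b : nat) : rel 'I_n :=
  fun j i => has (fun k => edge (A k) j i) (index_iota a b).

Definition strongly_connected (n : nat) (e : rel 'I_n) : Prop :=
  forall i j : 'I_n, connect e i j.

Definition doubly_stochastic (R : realType) (n : nat) (A : 'M[R]_n) : Prop :=
  (forall j : 'I_n, \sum_(i < n) A i j = 1) /\
  (forall i : 'I_n, \sum_(j < n) A i j = 1).

Definition average (R : realType) (n r : nat) (x : 'I_n -> 'rV[R]_r) :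
  'rV[R]_r := n%:R^-1 *: \sum_(i < n) x i.

Definition local_mix (R : realType) (n r : nat) (A : 'M[R]_n)
    (x : 'I_n -> 'rV[R]_r) (i : 'I_n) : 'rV[R]_r :=
  \sum_(j in (i |: neighbors A i)%SET) A i j *: x j.

Definition gr (R : realType) (r : nat) (f : 'rV[R]_r -> R) (q : R)
    (v : 'rV[R]_r) : 'rV[R]_r :=
  if Num.sqrt q <= enorm (grad f v) ^+ 2 then 0
  else (Num.sqrt q)^-1 *: grad f v.

Definition control (R : realType) (r : nat) (T gamma : R)
    (f : 'rV[R]_r -> R) (H : set 'rV[R]_r) (q : R) (v : 'rV[R]_r) :
  'rV[R]_r :=
  let w := v - T *: gr f q v in
  (1 - gamma) *: w + gamma *: eproj H w.

(* [x k i] and [q k i] are the state and the gain of agent [i] at time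
   [k * T]. *)
Definition algorithm (R : realType) (n r : nat) (T : R) (gamma : 'I_n -> R)
    (f : 'I_n -> 'rV[R]_r -> R) (H : 'I_n -> set 'rV[R]_r)
    (A : nat -> 'M[R]_n) (x : nat -> 'I_n -> 'rV[R]_r)
    (q : nat -> 'I_n -> R) : Prop :=
  forall (k : nat) (i : 'I_n),
    x k.+1 i = control T (gamma i) (f i) (H i) (q k i)
                 (local_mix (A k) (x k) i) /\
    q k.+1 i = q k i + atan (expR (enorm (x k i))) * T.

(* Main.v *)
Require Import Defs.
From mathcomp Require Import all_boot all_order all_algebra.
From mathcomp Require Import all_classical all_reals all_analysis.
From mathcomp Require Import ring lra zify.
Import Order.TTheory GRing.Theory Num.Theory.
Import numFieldNormedType.Exports.

(** The difficulty is that the step sizes [1 / sqrt (q k i)] differ from agent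
to agent and are not square summable, so that the usual summability arguments
for the subgradient method are not available.  The proof works with no rate at
all and has three stages, each using the previous one.

Boundedness ([x_bounded]).  A nonempty bounded set of critical points makes
each convex [f i] coercive ([convex_coercive]).  The truncation rule
bounds the squared length of [gr] by [1 / sqrt (q k i)], hence a gradient
step taken where [f i] exceeds its value at a feasible [s] by [T / 2] does not
increase the distance to [s] ([gr_step_far]).  Steps taken elsewhere start from
a fixed bounded set, and neither averaging nor projecting increases the largest
distance to [s].

Consensus ([eventually_consensus], [consensus]).  The gains grow linearly, so
the algorithm is projected averaging with a disturbance tending to [0].  The
energy, the sum of the squared distances to a feasible point, is dissipated by
the disagreement along the active arcs and by the length of the projections
([energy_step]).  As the energy is bounded, among boundedly many consecutive
windows there is one with little dissipation, and in such a window all agents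
are close to each other ([quiet_agree]), hence close to every [H i], hence by
compactness close to a point [h] of the intersection ([near_feasible]).  From
then on the distance to [h] grows only by the disturbance, which is negligible
over the bounded time until the next such window.

Optimality ([distance_to_optimal_vanish]).  By consensus the increments of the
gains become equal, so the ratios of the step sizes tend to [1]
([alpha_ratio]) and the agents jointly perform a gradient step for the sum of
the [f i], up to errors that are small compared with the step size ([descent]).
Hence the sum of the squared distances of the agents to the projection of
their average on the optimal set decreases by a fixed multiple of the step
size as long as the agents are not close to that set ([optimality_gap]), and
it is small right after they are.  The step sizes have a divergent sum, so
this quantity tends to [0] ([eventually_le_of_descent]). *)

Set Implicit Arguments.
Unset Strict Implicit.
Unset Printing Implicit Defensive.

Local Open Scope classical_set_scope.
Local Open Scope ring_scope.

(** * Euclidean geometry of row vectors *)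
Section Euclid.
Context {R : realType} {r : nat}.
Implicit Types u v w : 'rV[R]_r.

Definition dot u v : R := \sum_(j < r) u 0 j * v 0 j.

Lemma dotC u v : dot u v = dot v u.
Proof. by apply: eq_bigr => j _; rewrite mulrC. Qed.

Lemma dotDl u v w : dot (u + v) w = dot u w + dot v w.
Proof. by rewrite -big_split; apply: eq_bigr => j _; rewrite mxE mulrDl. Qed.

Lemma dotZl a u w : dot (a *: u) w = a * dot u w.
Proof. by rewrite mulr_sumr; apply: eq_bigr => j _; rewrite mxE mulrA. Qed.

Lemma dotNl u w : dot (- u) w = - dot u w.
Proof. by rewrite -scaleN1r dotZl mulN1r. Qed.

Lemma dotBl u v w : dot (u - v) w = dot u w - dot v w.
Proof. by rewrite dotDl dotNl. Qed.

Lemma dotDr u v w : dot w (u + v) = dot w u + dot w v.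
Proof. by rewrite !(dotC w) dotDl. Qed.

Lemma dotZr a u w : dot w (a *: u) = a * dot w u.
Proof. by rewrite !(dotC w) dotZl. Qed.

Lemma dotBr u v w : dot w (u - v) = dot w u - dot w v.
Proof. by rewrite !(dotC w) dotBl. Qed.

Lemma dot_suml (I : Type) (s : seq I) (F : I -> 'rV[R]_r) w :
  dot (\sum_(i <- s) F i) w = \sum_(i <- s) dot (F i) w.
Proof.
elim/big_rec2: _ => [|i y z _ <-]; last by rewrite dotDl.
by rewrite /dot big1 // => j _; rewrite mxE mul0r.
Qed.

Lemma dotvv_ge0 u : 0 <= dot u u.
Proof. by apply: sumr_ge0 => j _; rewrite -expr2 sqr_ge0. Qed.

Lemma enorm_ge0 u : 0 <= enorm u.
Proof. exact: sqrtr_ge0. Qed.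

Lemma enorm_sqr u : enorm u ^+ 2 = dot u u.
Proof.
rewrite sqr_sqrtr; first by apply: eq_bigr => j _; rewrite expr2.
by apply: sumr_ge0 => j _; rewrite sqr_ge0.
Qed.

Lemma enormZ a u : enorm (a *: u) = `|a| * enorm u.
Proof.
apply/eqP; rewrite -(@eqrXn2 _ 2) ?enorm_ge0 ?mulr_ge0 ?enorm_ge0 //.
by rewrite exprMn !enorm_sqr dotZl dotZr mulrA real_normK ?num_real ?expr2.
Qed.

Lemma enormN u : enorm (- u) = enorm u.
Proof. by rewrite -scaleN1r enormZ normrN normr1 mul1r. Qed.

Lemma enormB u v : enorm (u - v) = enorm (v - u).
Proof. by rewrite -enormN opprB. Qed.

Lemma enorm0 : enorm (0 : 'rV[R]_r) = 0.
Proof. by rewrite -(scale0r 0) enormZ normr0 mul0r. Qed.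

Lemma enorm_eq0 u : enorm u = 0 -> u = 0.
Proof.
move=> u0; have : dot u u == 0 by rewrite -enorm_sqr u0 expr0n.
rewrite psumr_eq0 => [/allP h|j _]; last by rewrite -expr2 sqr_ge0.
apply/rowP => j; rewrite mxE; apply/eqP.
by have := h j (mem_index_enum j); rewrite /= mulf_eq0 orbb.
Qed.

Lemma dot0l u : dot 0 u = 0.
Proof. by rewrite -(scale0r 0) dotZl mul0r. Qed.

Lemma dot0r u : dot u 0 = 0.
Proof. by rewrite dotC dot0l. Qed.

Lemma dot_le u v : dot u v <= enorm u * enorm v.
Proof.
have [/enorm_eq0 ->|u0] := eqVneq (enorm u) 0; first by rewrite dot0l enorm0 mul0r.
have [/enorm_eq0 ->|v0] := eqVneq (enorm v) 0; first by rewrite dot0r enorm0 mulr0.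
have ab : 0 < enorm u * enorm v by rewrite mulr_gt0 // lt_def enorm_ge0 andbT.
have := dotvv_ge0 (enorm v *: u - enorm u *: v).
rewrite !(dotBl, dotBr, dotZl, dotZr) -!enorm_sqr (dotC v u) => h.
rewrite -(ler_pM2l ab); nra.
Qed.

Lemma enormD_sqr u v :
  enorm (u + v) ^+ 2 = enorm u ^+ 2 + 2 * dot u v + enorm v ^+ 2.
Proof. by rewrite !enorm_sqr !(dotDl, dotDr) (dotC v u); ring. Qed.

Lemma enormB_sqr u v :
  enorm (u - v) ^+ 2 = enorm u ^+ 2 - 2 * dot u v + enorm v ^+ 2.
Proof. by rewrite !enorm_sqr !(dotBl, dotBr) (dotC v u); ring. Qed.

Lemma enormD u v : enorm (u + v) <= enorm u + enorm v.
Proof.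
rewrite -(@ler_pXn2r _ 2) ?nnegrE ?addr_ge0 ?enorm_ge0 // enormD_sqr.
have := dot_le u v; lra.
Qed.

Lemma enorm_dist v u w : enorm (u - w) <= enorm (u - v) + enorm (v - w).
Proof. by rewrite -[u - w](subrKA v) enormD. Qed.

Lemma enorm_sum (I : Type) (s : seq I) (F : I -> 'rV[R]_r) :
  enorm (\sum_(i <- s) F i) <= \sum_(i <- s) enorm (F i).
Proof.
elim/big_rec2: _ => [|i y z _ h]; first by rewrite enorm0.
by apply: le_trans (enormD _ _) _; rewrite lerD2l.
Qed.

Lemma coord_le_enorm u j : `|u 0 j| <= enorm u.
Proof.
rewrite -(@ler_pXn2r _ 2) ?nnegrE ?enorm_ge0 // enorm_sqr real_normK ?num_real //.
rewrite /dot (bigD1 j) //= -expr2 lerDl sumr_ge0 // => i _.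
by rewrite -expr2 sqr_ge0.
Qed.

(** With [bounded_enorm], this comparison makes the compactness and convergence
results for the sup norm applicable to [enorm]. *)
Lemma norm_le_enorm u : `|u| <= enorm u.
Proof.
rewrite [leLHS]/Num.Def.normr /= mx_normrE; apply/bigmax_leP; split=> [|[i j] _ /=]; first exact: enorm_ge0.
by rewrite ord1 coord_le_enorm.
Qed.

Lemma enorm_continuous : continuous (@enorm R r).
Proof.
move=> u; apply: continuous_comp; last exact: sqrt_continuous.
apply: continuous_big => [|j _]; first exact: add_continuous.
move=> s; apply: (@continuous_comp _ _ _ (fun s : 'rV[R]_r => s 0 j) (fun a => a ^+ 2)).
  exact: coord_continuous.
exact: exprn_continuous.
Qed.

Lemma enorm_dist_continuous (s : 'rV[R]_r) :
  continuous (fun t : 'rV[R]_r => enorm (s - t)).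
Proof.
have cB : continuous (fun t : 'rV[R]_r => s - t).
  move=> t.
  exact: (@cvgB _ _ _ (nbhs t) _ (fun=> s) id s t (cvg_cst _) cvg_id).
by move=> t; apply: continuous_comp; [exact: cB|exact: enorm_continuous].
Qed.

Lemma enorm_bounded (C : set 'rV[R]_r) s rho :
  (forall t, C t -> enorm (t - s) <= rho) -> bounded_set C.
Proof.
move=> h; exists (rho + enorm s); split; first exact: num_real.
move=> M hM t Ct /=.
apply: le_trans (norm_le_enorm _) _; apply: le_trans (ltW hM).
by rewrite -[in leLHS](subrK s t); apply: le_trans (enormD _ _) _; rewrite lerD2r h.
Qed.

Lemma bounded_enorm (C : set 'rV[R]_r) s :
  bounded_set C -> exists rho, forall t, C t -> enorm (t - s) <= rho.
Proof.
move=> [M [_ hM]].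
exists (Num.sqrt (\sum_(j < r) (M + 1) ^+ 2) + enorm s) => t Ct.
apply: le_trans (enormD _ _) _; rewrite enormN lerD2r ler_wsqrtr // ler_sum // => j _.
have h : `|t| <= M + 1 by apply: hM => //; rewrite ltrDl.
have h' : `|t 0 j| <= `|t|.
  rewrite [leRHS]/Num.Def.normr /= mx_normrE.
  exact: (le_bigmax_cond _ (j := (0, j)) (fun ij : 'I_1 * 'I_r => `|t ij.1 ij.2|)).
by rewrite -real_normK ?num_real // lerXn2r ?nnegrE ?(le_trans _ h) // (le_trans h').
Qed.

End Euclid.

(** * Minimization, compactness and projection *)
Lemma cvg_squeeze_dist (R : realType) (T : topologicalType) (g h : T -> R) s :
  (forall t, `|g s - g t| <= h t) -> h t @[t --> s] --> 0 ->
  g t @[t --> s] --> g s.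
Proof.
move=> gh /cvgrPdist_lt h0; apply/cvgrPdist_lt => e /h0; apply: filterS => t.
rewrite sub0r normrN; apply: le_lt_trans.
by apply: le_trans (gh t) _; exact: ler_norm.
Qed.

Section Minimization.
Context {R : realType} {r : nat}.
Implicit Types (K C : set 'rV[R]_r) (s t : 'rV[R]_r) (g : 'rV[R]_r -> R).

Lemma closed_sublevel g a : continuous g -> closed [set t | g t <= a].
Proof.
move=> cg; rewrite (_ : [set t | _] = g @^-1` [set y | y <= a]) //.
by apply: closed_comp => [t _|]; [exact: cg|exact: closed_le].
Qed.

Lemma closed_superlevel g a : continuous g -> closed [set t | a <= g t].
Proof.
move=> cg; rewrite (_ : [set t | _] = g @^-1` [set y | a <= y]) //.
by apply: closed_comp => [t _|]; [exact: cg|exact: closed_ge].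
Qed.

(** Only the part of [K] where [g] is at most [g t0] matters, and it is
compact. *)
Lemma minimizers_nonempty g K t0 s rho : continuous g -> closed K -> K t0 ->
  (forall t, K t -> g t <= g t0 -> enorm (t - s) <= rho) ->
  minimizers g K !=set0.
Proof.
move=> cg cK Kt0 hb.
have := @EVT_min_rV R r g (K `&` [set t | g t <= g t0]) _ _ _; case.
- by exists t0; split=> //=.
- apply: bounded_closed_compact; last first.
    by apply: closedI => //; exact: closed_sublevel.
  by apply: (@enorm_bounded _ _ _ s rho) => t [Kt /hb]; exact.
- exact: continuous_subspaceT.
move=> c /set_mem[Kc /= c0] hc; exists c; split=> // t Kt.
case: (leP (g t) (g t0)) => [h|/ltW/(le_trans c0)//].
by apply: hc; apply/mem_set.
Qed.

(** This is how every quantitative constant of the proof is obtained: the growth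
rate in [convex_coercive], the tolerance in [near_feasible] and the gap in
[optimality_gap]. *)
Lemma positive_on_compact g C s rho : continuous g -> closed C ->
  (forall t, C t -> enorm (t - s) <= rho) -> (forall t, C t -> 0 < g t) ->
  exists2 mu, 0 < mu & forall t, C t -> mu <= g t.
Proof.
move=> cg cC hb gp.
case: (pselect (C !=set0)) => [C0|nC]; last first.
  by exists 1 => // t Ct; case: nC; exists t.
have := @EVT_min_rV R r g C C0 _ _; case.
- exact: bounded_closed_compact (enorm_bounded hb) cC.
- exact: continuous_subspaceT.
move=> c /set_mem Cc hc; exists (g c); first exact: gp.
by move=> t Ct; apply: hc; apply/mem_set.
Qed.

Lemma eprojP K s : closed K -> K !=set0 ->
  minimizers (fun t => enorm (s - t)) K (eproj K s).
Proof.
move=> cK [t0 Kt0].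
have [c hc] : minimizers (fun t => enorm (s - t)) K !=set0.
  apply: (@minimizers_nonempty _ _ t0 s (enorm (s - t0))) => //.
    exact: enorm_dist_continuous.
  by move=> t _; rewrite enormB.
exact: xgetI hc.
Qed.

Lemma eproj_in K s : closed K -> K !=set0 -> K (eproj K s).
Proof. by move=> cK K0; case: (eprojP s cK K0). Qed.

Lemma eproj_min K s t : closed K -> K t ->
  enorm (s - eproj K s) <= enorm (s - t).
Proof. by move=> cK Kt; case: (eprojP s cK (ex_intro _ t Kt)) => _; apply. Qed.

(** The distance to a set is 1-Lipschitz. *)
Lemma eproj_dist_continuous K : closed K -> K !=set0 ->
  continuous (fun s => enorm (s - eproj K s)).
Proof.
move=> cK K0.
have lip s t : enorm (s - eproj K s) <= enorm (t - eproj K t) + enorm (s - t).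
  apply: le_trans (eproj_min s cK (eproj_in t cK K0)) _.
  by rewrite [leRHS]addrC; exact: enorm_dist.
move=> s; apply: (@cvg_squeeze_dist _ _ _ (fun t => enorm (s - t))) => [t|].
  have := lip t s; have := lip s t; rewrite (enormB t s).
  by move: (enorm _) (enorm _) (enorm _) => a b c h h'; rewrite ler_norml; lra.
have := @enorm_dist_continuous R r s s.
by rewrite /continuous_at subrr enorm0.
Qed.

Lemma conv_mem K s t a : @convex_set R 'rV[R]_r K -> K s -> K t ->
  0 <= a <= 1 -> K (s + a *: (t - s)).
Proof.
move=> cK Ks Kt /andP[a0 a1].
have := cK t s (Itv01 a0 a1); rewrite !inE => /(_ Kt Ks).
rewrite (_ : s + _ = a *: t + (1 - a) *: s) //.
by rewrite scalerBl scale1r scalerBr addrCA.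
Qed.

(** A first-order condition: a linear term bounded by a quadratic one, after
division by the parameter. *)
Lemma nonpos_of_small_le (a b : R) :
  (forall t : R, 0 < t -> t <= 1 -> a <= t * b) -> a <= 0.
Proof.
move=> h; rewrite leNgt; apply/negP => a0.
have b0 : a <= b by have := h 1 ltr01 (lexx _); rewrite mul1r.
have bp : 0 < b by exact: lt_le_trans b0.
have := h (a / (2 * b)); rewrite divr_gt0 ?mulr_gt0 // => /(_ isT).
rewrite ler_pdivrMr ?mulr_gt0 // mul1r => /(_ ltac:(lra)).
rewrite invfM mulrA -mulrA mulVf ?gt_eqF // mulr1; lra.
Qed.

(** Moving from the projection towards [t] stays in [K], so it cannot bring the
point closer to [s] to first order. *)
Lemma eproj_obtuse K s t : closed K -> @convex_set R 'rV[R]_r K -> K t ->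
  dot (s - eproj K s) (t - eproj K s) <= 0.
Proof.
move=> cK xK Kt; set p := eproj K s.
have K0 : K !=set0 by exists t.
apply: (@nonpos_of_small_le _ (enorm (t - p) ^+ 2)) => a a0 a1.
have Kp : K p by exact: eproj_in.
have := eproj_min s cK (conv_mem xK Kp Kt (a := a) ltac:(by rewrite ltW)).
rewrite -/p -(@ler_pXn2r _ 2) ?nnegrE ?enorm_ge0 // opprD addrA.
rewrite [in leRHS]enormB_sqr dotZr enormZ exprMn real_normK ?num_real //.
move=> h; have := sqr_ge0 (enorm (t - p)).
set D := enorm (t - p) ^+ 2 in h *; nra.
Qed.

(** The law of cosines at the projection, where the angle is obtuse.  The last
term is the dissipation due to projecting. *)
Lemma eproj_pythagoras K s t : closed K -> @convex_set R 'rV[R]_r K -> K t ->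
  enorm (eproj K s - t) ^+ 2 <= enorm (s - t) ^+ 2 - enorm (eproj K s - s) ^+ 2.
Proof.
move=> cK xK Kt; have := eproj_obtuse s cK xK Kt; set p := eproj K s => h.
have -> : s - t = (s - p) - (t - p) by rewrite opprB addrA subrK.
rewrite (enormB_sqr (s - p)) (enormB p t) (enormB p s).
move: (enorm _ ^+ 2) (enorm _ ^+ 2) (dot _ _) h => a b c; lra.
Qed.

Lemma eproj_le K s t : closed K -> @convex_set R 'rV[R]_r K -> K t ->
  enorm (eproj K s - t) <= enorm (s - t).
Proof.
move=> cK xK Kt; rewrite -(@ler_pXn2r _ 2) ?nnegrE ?enorm_ge0 //.
have := eproj_pythagoras s cK xK Kt.
by have := sqr_ge0 (enorm (eproj K s - s)); lra.
Qed.

End Minimization.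

(** * Differentiable convex functions *)
Section Convex.
Context {R : realType} {r : nat}.
Variable f : 'rV[R]_r -> R.
Hypothesis f_diff : forall s, differentiable f s.

Lemma everywhere_differentiable_continuous : continuous f.
Proof. by move=> s; exact/differentiable_continuous/f_diff. Qed.

Lemma derive_dot s v : 'D_v f s = dot (grad f s) v.
Proof.
rewrite deriveE // [in LHS](row_sum_delta v) linear_sum; apply: eq_bigr => j _.
by rewrite linearZ mxE -deriveE // mulrC.
Qed.

(** A derivative is a one-sided limit of difference quotients, so a bound on one
side suffices. *)
Lemma derive_le s v c :
  (forall t, 0 < t -> t <= 1 -> f (s + t *: v) - f s <= t * c) ->
  dot (grad f s) v <= c.
Proof.
move=> h; rewrite -derive_dot.
have cv : (fun t => t^-1 *: ((f \o shift s) (t *: v) - f s)) @ 0^' --> 'D_v f s.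
  exact: diff_derivable.
apply: (cvgr_to_le (cvg_dnbhs_at_right cv)); near=> t.
have t0 : 0 < t by near: t; exact: nbhs_right_gt.
rewrite /= -[_ *: _]/(t^-1 * _) ler_pdivrMl // [_ + s]addrC h //.
by near: t; apply: nbhs_right_le.
Unshelve. all: by end_near. Qed.

Lemma derive_ge s v c :
  (forall t, 0 < t -> t <= 1 -> t * c <= f (s + t *: v) - f s) ->
  c <= dot (grad f s) v.
Proof.
move=> h; rewrite -derive_dot.
have cv : (fun t => t^-1 *: ((f \o shift s) (t *: v) - f s)) @ 0^' --> 'D_v f s.
  exact: diff_derivable.
apply: (cvgr_to_ge (cvg_dnbhs_at_right cv)); near=> t.
have t0 : 0 < t by near: t; exact: nbhs_right_gt.
rewrite /= -[_ *: _]/(t^-1 * _) ler_pdivlMl // [_ + s]addrC h //.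
by near: t; apply: nbhs_right_le.
Unshelve. all: by end_near. Qed.

Lemma grad_eq0_of_min s : (forall t, f s <= f t) -> grad f s = 0.
Proof.
move=> smin; apply: enorm_eq0; apply/eqP; rewrite -sqrf_eq0.
rewrite eq_le sqr_ge0 andbT enorm_sqr -oppr_ge0 -dotNl dotC.
rewrite -[leLHS](mulr0 0); apply: derive_ge => t _ _.
by rewrite !mulr0 subr_ge0.
Qed.

Hypothesis f_convex : @convex_function R 'rV[R]_r [set: 'rV[R]_r] f.

Lemma convexE s t a : 0 <= a <= 1 ->
  f (s + a *: (t - s)) <= f s + a * (f t - f s).
Proof.
case/andP=> a0 a1; have := f_convex (Itv01 a0 a1) (mem_set (I : setT t)) (mem_set (I : setT s)).
rewrite (_ : s + _ = a *: t + (1 - a) *: s); last first.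
  by rewrite scalerBl scale1r scalerBr addrCA.
move=> /le_trans; apply; rewrite le_eqVlt; apply/orP; left; apply/eqP.
by rewrite [LHS](_ : _ = a * f t + (1 - a) * f s) //; ring.
Qed.

Lemma grad_le s t : dot (grad f s) (t - s) <= f t - f s.
Proof.
apply: derive_le => a a0 a1; have := @convexE s t a; rewrite ltW // a1 => /(_ isT).
by rewrite lerBlDl.
Qed.

(** Critical points are the minimizers, so on a sphere around one of them that
encloses all the others [f] exceeds its minimum by some [mu > 0].  By convexity
[f] then grows at least linearly outside that sphere. *)
Lemma convex_coercive :
  [set s | grad f s = 0] !=set0 -> bounded_set [set s | grad f s = 0] ->
  forall c s, exists rho, forall t, f t <= c -> enorm (t - s) <= rho.
Proof.
move=> [z /= z0] bz c s.
have zmin t : f z <= f t by rewrite -subr_ge0 (le_trans _ (grad_le z t)) // z0 dot0l.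
have [rho0 hrho0] := bounded_enorm z bz.
(* Beyond [rho0] there is no critical point, so none lies on the sphere of radius
   [rho]. *)
pose rho := `|rho0| + 1.
have rho_gt : rho0 < rho by rewrite /rho; have := ler_norm rho0; lra.
have rho_gt0 : 0 < rho by rewrite /rho; have := normr_ge0 rho0; lra.
have cont := @enorm_dist_continuous R r z.
pose S := [set t : 'rV[R]_r | enorm (z - t) <= rho] `&` [set t | rho <= enorm (z - t)].
have cS : closed S.
  by apply: closedI; [exact: closed_sublevel|exact: closed_superlevel].
have [mu mu0 hmu] : exists2 mu, 0 < mu & forall t, S t -> mu <= f t - f z.
  apply: (@positive_on_compact R r _ S z rho) => //.
  - move=> t; apply: (@cvgB _ _ _ (nbhs t) _ f (cst (f z))); last exact: cvg_cst.
    exact: everywhere_differentiable_continuous.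
  - by move=> t [/= h _]; rewrite enormB.
  move=> t [/= _ h]; rewrite subr_gt0 ltNge; apply/negP => tz.
  have /hrho0 : grad f t = 0.
    by apply: grad_eq0_of_min => y; exact: le_trans (zmin y).
  rewrite enormB; lra.
exists (rho + rho * `|c - f z| / mu + enorm (z - s)) => t tc.
apply: le_trans (enorm_dist z _ _) _; rewrite lerD2r.
have p0 : 0 <= rho * `|c - f z| / mu.
  by rewrite divr_ge0 ?mulr_ge0 // ltW.
set D := enorm (t - z); case: (leP D rho) => [|D_gt]; first lra.
have D0 : 0 < D by exact: lt_trans D_gt.
have a1 : 0 <= rho / D <= 1.
  by rewrite divr_ge0 ?(ltW rho_gt0) ?(ltW D0) // ler_pdivrMr // mul1r ltW.
have Sy : S (z + (rho / D) *: (t - z)).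
  have e : enorm (z - (z + (rho / D) *: (t - z))) = rho.
    rewrite opprD addrA subrr sub0r enormN enormZ -/D ger0_norm; last by case/andP: a1.
    by rewrite divfK ?gt_eqF.
  by split; rewrite /= e.
have := le_trans (hmu _ Sy) (lerB (convexE z t a1) (lexx (f z))).
rewrite addrAC subrr add0r => h.
have h2 : mu * D <= rho * `|c - f z|.
  have : mu <= rho / D * `|c - f z|.
    apply: le_trans h _; apply: ler_wpM2l; first by case/andP: a1.
    by apply: le_trans (ler_norm _); rewrite lerD2r.
  by rewrite mulrAC ler_pdivlMr.
suff : D <= rho * `|c - f z| / mu by lra.
by rewrite ler_pdivlMr // mulrC.
Qed.

(** A unit step along the gradient raises [f] by at least the norm of the
gradient, while [f] is bounded on a slightly larger ball. *)
Lemma grad_bounded s rho :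
  exists2 G, 0 < G & forall t, enorm (t - s) <= rho -> enorm (grad f t) <= G.
Proof.
pose C := [set t : 'rV[R]_r | enorm (s - t) <= rho + 1].
have cC : compact C.
  apply: bounded_closed_compact; last exact/closed_sublevel/enorm_dist_continuous.
  by apply: (@enorm_bounded _ _ _ s (rho + 1)) => t; rewrite /C /= enormB.
have : bounded_set (f @` C).
  apply: compact_bounded; apply: continuous_compact => //.
  exact/continuous_subspaceT/everywhere_differentiable_continuous.
move=> [M [_ /(_ (M + 1))]]; rewrite ltrDl ltr01 => /(_ isT) hM.
have fM t : C t -> `|f t| <= M + 1 by move=> Ct; apply: hM; exists t.
exists (1 + 2 * `|M + 1|) => [|t tr].
  by have := normr_ge0 (M + 1); lra.
have [->|g0] := eqVneq (enorm (grad f t)) 0; first by have := normr_ge0 (M + 1); lra.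
have gp : 0 < enorm (grad f t) by rewrite lt_def g0 enorm_ge0.
pose y := t + (enorm (grad f t))^-1 *: grad f t.
have Cy : C y.
  rewrite /C /= enormB /y addrAC; apply: le_trans (enormD _ _) _.
  by rewrite enormZ ger0_norm ?invr_ge0 ?enorm_ge0 // mulVf // lerD2r.
have Ct : C t by rewrite /C /= enormB; lra.
have := grad_le t y; rewrite /y addrAC subrr add0r dotZr -enorm_sqr expr2 mulKf //.
rewrite -/y => h.
have := fM _ Ct; have := fM _ Cy; rewrite !ler_norml => /andP[_ a1] /andP[b1 _].
by have := ler_norm (M + 1); lra.
Qed.

Lemma lipschitz_of_grad s t G : enorm (grad f s) <= G ->
  f s - f t <= G * enorm (s - t).
Proof.
move=> hG; have := grad_le s t; have := dot_le (grad f s) (s - t).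
have : enorm (grad f s) * enorm (s - t) <= G * enorm (s - t).
  by rewrite ler_wpM2r ?enorm_ge0.
rewrite -[t - s]opprB [dot _ (- _)]dotC dotNl (dotC (s - t)).
move: (dot _ _) (_ * _) (_ * _) => a b c; lra.
Qed.

End Convex.

(** * Averaging with doubly stochastic weights *)
Section Averages.
Context {R : realType} {n r : nat}.
Implicit Types (p : 'I_n -> R) (y : 'I_n -> 'rV[R]_r) (s : 'rV[R]_r) (A : 'M[R]_n).

(** The cross terms cancel because the deviations from the weighted mean have
weighted sum [0]. *)
Lemma variance_identity p y s : \sum_j p j = 1 ->
  \sum_j p j * enorm (y j - s) ^+ 2 =
  enorm (\sum_j p j *: y j - s) ^+ 2 +
  \sum_j p j * enorm (y j - \sum_j p j *: y j) ^+ 2.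
Proof.
move=> p1; set v := \sum_j p j *: y j.
have cross : \sum_j p j * dot (y j - v) (v - s) = 0.
  have -> : \sum_j p j * dot (y j - v) (v - s) = dot (\sum_j p j *: (y j - v)) (v - s).
    by rewrite dot_suml; apply: eq_bigr => j _; rewrite dotZl.
  under eq_bigr do rewrite scalerBr.
  by rewrite sumrB -scaler_suml p1 scale1r subrr dot0l.
transitivity (\sum_j (p j * enorm (y j - v) ^+ 2 + 2 * (p j * dot (y j - v) (v - s))
    + p j * enorm (v - s) ^+ 2)).
  apply: eq_bigr => j _; rewrite -[y j - s](subrKA v) (enormD_sqr (y j - v)); ring.
rewrite !big_split /= -mulr_sumr cross mulr0 addr0 -mulr_suml p1 mul1r.
by rewrite addrC.
Qed.

Lemma enorm_mean_le p y s rho : (forall j, 0 <= p j) -> \sum_j p j = 1 ->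
  (forall j, enorm (y j - s) <= rho) -> enorm (\sum_j p j *: y j - s) <= rho.
Proof.
move=> p0 p1 hy.
have -> : \sum_j p j *: y j - s = \sum_j p j *: (y j - s).
  under [RHS]eq_bigr do rewrite scalerBr.
  by rewrite sumrB -scaler_suml p1 scale1r.
apply: le_trans (enorm_sum _ _) _.
rewrite -[rho]mul1r -p1 mulr_suml; apply: ler_sum => j _.
by rewrite enormZ ger0_norm // ler_wpM2l.
Qed.

Lemma local_mixE A y i : (forall i j, 0 <= A i j) ->
  local_mix A y i = \sum_j A i j *: y j.
Proof.
move=> A0; rewrite /local_mix [RHS](bigID [in (i |: neighbors A i)%SET]) /=.
rewrite [X in _ = _ + X]big1 ?addr0 // => j; rewrite !inE negb_or => /andP[ji].
rewrite ji /= => Aij; suff -> : A i j = 0 by rewrite scale0r.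
by apply: le_anti; rewrite A0 andbT leNgt.
Qed.

(** The row sums give the variance identity at each agent, and the column sums
say that every agent is counted with total weight 1.  The double sum is the
energy dissipated by disagreement. *)
Lemma sum_local_mix A y s : (forall i j, 0 <= A i j) -> doubly_stochastic A ->
  \sum_i enorm (local_mix A y i - s) ^+ 2 +
  \sum_i \sum_j A i j * enorm (y j - local_mix A y i) ^+ 2 =
  \sum_j enorm (y j - s) ^+ 2.
Proof.
move=> A0 [Ac Ar]; rewrite -big_split /=.
transitivity (\sum_i \sum_j A i j * enorm (y j - s) ^+ 2).
  by apply: eq_bigr => i _; rewrite local_mixE // -variance_identity.
by rewrite exchange_big; apply: eq_bigr => j _; rewrite -mulr_suml Ac mul1r.
Qed.

Lemma local_mix_le A y s rho i : (forall i j, 0 <= A i j) -> doubly_stochastic A ->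
  (forall j, enorm (y j - s) <= rho) -> enorm (local_mix A y i - s) <= rho.
Proof. by move=> A0 [_ Ar] hy; rewrite local_mixE // enorm_mean_le. Qed.

(** A path can be chosen without repeated vertices, hence with fewer than [n]
arcs. *)
Lemma connect_enorm_le (e : rel 'I_n) y sigma i j : 0 <= sigma ->
  (forall i j, e i j -> enorm (y i - y j) <= sigma) -> connect e i j ->
  enorm (y i - y j) <= n%:R * sigma.
Proof.
move=> sigma0 he /connectP[p0 ep0 ->]; case/shortenP: ep0 => p ep up _.
have le_size : enorm (y i - y (last i p)) <= (size p)%:R * sigma.
  elim: p i ep {up} => [|k p IH] i /=; first by rewrite subrr enorm0 mul0r.
  case/andP=> eik /IH h; apply: le_trans (enorm_dist (y k) _ _) _.
  by rewrite -natr1 mulrDl mul1r addrC lerD // he.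
apply: le_trans le_size _; rewrite ler_wpM2r // ler_nat.
have := max_card [in i :: p]; rewrite card_ord (card_uniqP up) /=; exact: ltnW.
Qed.

(** A window of length [M + M] starting at any time contains a whole interval
between two consecutive switching times, so connectivity need not refer to the
switching times any more. *)
Lemma windows_connected (B : nat -> 'M[R]_n) M (kappa : nat -> nat) :
  kappa 0%N = 0%N ->
  (forall j, (0 < kappa j.+1 - kappa j <= M)%N /\
     strongly_connected (union_edge B (kappa j) (kappa j.+1))) ->
  forall k, strongly_connected (union_edge B k (k + (M + M))).
Proof.
move=> kappa0 hk k.
have [j [kj jM]] : exists j, (k <= kappa j /\ kappa j <= k + M)%N.
  elim: k => [|k [j [kj jM]]]; first by exists 0%N; rewrite kappa0.
  have [/andP[h1 h2] _] := hk j.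
  by case: (ltnP k (kappa j)) => h; [exists j|exists j.+1]; lia.
move=> u v; have [/andP[h1 h2] /(_ u v)] := hk j.
apply: connect_sub => a b /hasP[t]; rewrite mem_index_iota => ht eab.
by apply/connect1/hasP; exists t => //; rewrite mem_index_iota; lia.
Qed.

End Averages.

(** * Points close to all the constraint sets *)
Section Feasibility.
Context {R : realType} {n r : nat}.
Variable H : 'I_n -> set 'rV[R]_r.
Hypothesis H_closed : forall i, closed (H i).
Hypothesis H_nonempty : \bigcap_(i in [set: 'I_n]) H i !=set0.

Lemma feasible_closed : closed (\bigcap_(i in [set: 'I_n]) H i).
Proof. by apply: closed_bigI => i _; exact: H_closed. Qed.

(** The sum of the distances to the sets [H i] is continuous and vanishes only
on their intersection.  It is thus bounded below on the compact set of the
points of the ball whose distance to the intersection is at least [w]. *)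
Lemma near_feasible s rho w : 0 < w ->
  exists2 delta, 0 < delta & forall t, enorm (t - s) <= rho ->
    (forall i, exists2 z, H i z & enorm (t - z) <= delta) ->
    exists2 h, (\bigcap_(i in [set: 'I_n]) H i) h & enorm (t - h) <= w.
Proof.
move=> w0; set HH := \bigcap_(i in [set: 'I_n]) H i.
have cHH := feasible_closed.
have Hi0 i : H i !=set0 by case: H_nonempty => z hz; exists z; exact: hz.
pose C := [set t : 'rV[R]_r | enorm (s - t) <= rho] `&`
          [set t | w <= enorm (t - eproj HH t)].
have [||||mu mu0 hmu] := @positive_on_compact R r
    (fun t => \sum_i enorm (t - eproj (H i) t)) C s rho.
- apply: continuous_big => [|i _]; first exact: add_continuous.
  exact: eproj_dist_continuous.
- apply: closedI; first exact/closed_sublevel/enorm_dist_continuous.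
  by apply: closed_superlevel; exact: eproj_dist_continuous.
- by move=> t [/= h _]; rewrite enormB.
- move=> t [_ /= ht]; rewrite lt_def sumr_ge0 ?andbT => [|i _]; last exact: enorm_ge0.
  apply/eqP => /eqP; rewrite psumr_eq0 => [/allP h|i _]; last exact: enorm_ge0.
  have tH : HH t.
    move=> i _; have /eqP/enorm_eq0/eqP := h i (mem_index_enum i).
    by rewrite subr_eq0 => /eqP ->; exact: eproj_in.
  have := eproj_min t cHH tH; rewrite subrr enorm0; lra.
exists (mu / (n%:R + 1)); first by rewrite divr_gt0 // ltr_wpDl.
move=> t ts tH; exists (eproj HH t); first exact: eproj_in.
rewrite leNgt; apply/negP => /ltW tw.
have : C t by split; rewrite //= enormB.
move=> /hmu; apply/negP; rewrite -ltNge.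
apply: (@le_lt_trans _ _ (\sum_(i < n) mu / (n%:R + 1))).
  apply: ler_sum => i _; have [z Hz tz] := tH i.
  by apply: le_trans tz; exact: eproj_min.
rewrite sumr_const card_ord -(mulr_natr (mu / _)) mulrAC ltr_pdivrMr ?ltr_wpDl //.
by rewrite ltr_pM2l // ltrDl.
Qed.

End Feasibility.

(** * Consensus of projected averaging under a vanishing disturbance *)

(** A potential with values between [0] and [c] can drop by [gamma] at most
[c / gamma] times in a row. *)
Lemma bounded_gain_recurrent (R : realType) (V : nat -> R) (good : nat -> Prop)
    (B K : nat) (c gamma : R) : 0 < gamma ->
  (forall k, 0 <= V k <= c) ->
  (forall k, (K <= k)%N -> good k \/ V (k + B)%N <= V k - gamma) ->
  exists N, forall k, (K <= k)%N -> exists2 m, (m <= N)%N & good (k + m)%N.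
Proof.
move=> g0 Vc hV.
pose N := (Num.truncn (c / gamma)).+1.
have Ng : c < N%:R * gamma.
  by rewrite -ltr_pdivrMr // truncnS_gt.
exists (N * B)%N => k Kk; apply: contrapT => nogood.
have desc m : (m <= N)%N -> V (k + m * B)%N <= V k - m%:R * gamma.
  elim: m => [|m IH] mN; first by rewrite mul0n addn0 mul0r subr0.
  case: (hV (k + m * B)%N ltac:(lia)) => [h|h].
    by case: nogood; exists (m * B)%N => //; rewrite leq_mul2r ltnW ?orbT.
  have -> : (k + m.+1 * B = k + m * B + B)%N by rewrite mulSn; lia.
  by have := IH (ltnW mN); rewrite -natr1 mulrDl mul1r; move: h; lra.
have := desc N (leqnn _); have /andP[_ h1] := Vc k.
have /andP[h2 _] := Vc (k + N * B)%N; lra.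
Qed.

Lemma term_le_sum (R : realType) n (F : 'I_n -> R) i :
  (forall j, 0 <= F j) -> F i <= \sum_j F j.
Proof. by move=> F0; rewrite (bigD1 i) //= lerDl sumr_ge0. Qed.

Section Consensus.
Context {R : realType} {n r : nat}.
Variables (H : 'I_n -> set 'rV[R]_r) (A : nat -> 'M[R]_n).
Variables (x d : nat -> 'I_n -> 'rV[R]_r) (s : 'rV[R]_r) (rho eta : R) (B : nat).
Let HH := \bigcap_(i in [set: 'I_n]) H i.
Hypothesis H_closed : forall i, closed (H i).
Hypothesis H_convex : forall i, @convex_set R 'rV[R]_r (H i).
Hypothesis A_ge0 : forall k i j, 0 <= A k i j.
Hypothesis A_stoch : forall k, doubly_stochastic (A k).
Hypothesis eta_range : 0 < eta <= 1.
Hypothesis A_diag : forall k i, eta <= A k i i.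
Hypothesis A_eta : forall k i j, A k i j != 0 -> eta <= A k i j.
Hypothesis A_conn : forall k, strongly_connected (union_edge A k (k + B)).
Hypothesis x_step : forall k i,
  x k.+1 i = eproj (H i) (local_mix (A k) (x k) i + d k i).
Hypothesis x_mem : forall k i, H i (x k i).
Hypothesis s_mem : HH s.
Hypothesis x_bounded : forall k i, enorm (x k i - s) <= rho.
Hypothesis d_vanish : forall e, 0 < e ->
  exists K, forall k i, (K <= k)%N -> enorm (d k i) <= e.

Let v k i := local_mix (A k) (x k) i.
Let energy k := \sum_i enorm (x k i - s) ^+ 2.
Let loss k := \sum_i enorm (x k.+1 i - (v k i + d k i)) ^+ 2 +
  \sum_i \sum_j A k i j * enorm (x k j - v k i) ^+ 2.

(** Averaging does not increase the largest distance to the common point [h],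
and projecting on a convex set containing [h] does not increase distances to
[h]; only the disturbance does. *)
Lemma stay_close h k m e c : HH h ->
  (forall t i, (k <= t)%N -> enorm (d t i) <= e) ->
  (forall i, enorm (x k i - h) <= c) ->
  forall i, enorm (x (k + m)%N i - h) <= c + m%:R * e.
Proof.
move=> Hh he hc; elim: m => [|m IH] i; first by rewrite addn0 mul0r addr0.
rewrite addnS x_step.
have Hih : H i h by exact: Hh.
have := eproj_le (local_mix (A (k + m)%N) (x (k + m)%N) i + d (k + m)%N i) (@H_closed i) (@H_convex i) Hih.
move=> /le_trans; apply.
rewrite addrAC; apply: le_trans (enormD _ _) _; rewrite -natr1 mulrDl mul1r addrA.
by apply: lerD; [exact: local_mix_le|apply: he; rewrite leq_addr].
Qed.

(** Here the energy is measured from the feasible point [s] alone.  Its possible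
growth is linear in the size of the disturbance, which is why a disturbance
tending to [0], however slowly, is enough for consensus. *)
Lemma energy_step k e : 0 <= e <= 1 -> (forall i, enorm (d k i) <= e) ->
  energy k.+1 + loss k <= energy k + n%:R * (2 * rho + 1) * e.
Proof.
move=> /andP[e0 e1] he.
have rw i : enorm (x k.+1 i - s) ^+ 2 + enorm (x k.+1 i - (v k i + d k i)) ^+ 2 <=
    enorm (v k i - s) ^+ 2 + (2 * rho + 1) * e.
  rewrite x_step -/(v k i).
  have := eproj_pythagoras (v k i + d k i) (@H_closed i) (@H_convex i) ((s_mem : HH s) i I).
  have vr : enorm (v k i - s) <= rho by exact: local_mix_le.
  have : enorm (v k i + d k i - s) <= enorm (v k i - s) + e.
    by rewrite addrAC; apply: le_trans (enormD _ _) _; rewrite lerD2l.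
  have := enorm_ge0 (v k i + d k i - s); have := enorm_ge0 (v k i - s).
  move: vr; set a := enorm (v k i - s); set b := enorm (_ - s).
  move: (enorm _ ^+ 2) (enorm _ ^+ 2) => p q ar a0 b0 ba pq.
  have : b ^+ 2 <= (a + e) ^+ 2 by rewrite lerXn2r ?nnegrE ?addr_ge0.
  nra.
rewrite /loss addrA -big_split /=.
apply: le_trans (lerD (ler_sum _ (fun i _ => rw i)) (lexx _)) _.
rewrite big_split /= addrAC sum_local_mix // lerD2l sumr_const card_ord.
by rewrite -(mulr_natl (_ * e)) mulrA.
Qed.

(** Every term of [loss] is nonnegative, and the arcs that are present have
weight at least [eta]; the diagonal weights link [x k i] to its own average. *)
Lemma small_loss k sigma : 0 <= sigma -> loss k <= eta * sigma ^+ 2 ->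
  (forall i, enorm (d k i) <= sigma) ->
  (forall i, enorm (x k.+1 i - x k i) <= 3 * sigma) /\
  (forall i j, A k i j != 0 -> enorm (x k j - x k i) <= 2 * sigma).
Proof.
move=> sigma0 hl hd; have /andP[eta0 eta1] := eta_range.
have term_ge0 i : 0 <= \sum_j A k i j * enorm (x k j - v k i) ^+ 2.
  by apply: sumr_ge0 => j _; rewrite mulr_ge0 ?sqr_ge0.
have xw i : enorm (x k.+1 i - (v k i + d k i)) <= sigma.
  rewrite -(@ler_pXn2r _ 2) ?nnegrE ?enorm_ge0 //.
  have h1 := term_le_sum i (fun l => sqr_ge0 (enorm (x k.+1 l - (v k l + d k l)))).
  apply: le_trans h1 _; apply: (@le_trans _ _ (loss k)).
    by rewrite lerDl sumr_ge0.
  by apply: le_trans hl _; rewrite ler_piMl // sqr_ge0.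
have xv i j : A k i j != 0 -> enorm (x k j - v k i) <= sigma.
  move=> Aij; rewrite -(@ler_pXn2r _ 2) ?nnegrE ?enorm_ge0 // -(ler_pM2l eta0).
  apply: le_trans hl; apply: (@le_trans _ _ (A k i j * enorm (x k j - v k i) ^+ 2)).
    by rewrite ler_wpM2r ?sqr_ge0 // A_eta.
  have h1 := term_le_sum j (fun l => mulr_ge0 (A_ge0 k i l) (sqr_ge0 (enorm (x k l - v k i)))).
  apply: le_trans h1 _; apply: le_trans (term_le_sum i term_ge0) _.
  by rewrite lerDr; apply: sumr_ge0 => l _; exact: sqr_ge0.
have Aii i : A k i i != 0 by rewrite gt_eqF // (lt_le_trans eta0).
split=> [i|i j Aij].
  apply: le_trans (enorm_dist (v k i + d k i) _ _) _.
  have : enorm (v k i + d k i - x k i) <= enorm (v k i - x k i) + enorm (d k i).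
    by rewrite addrAC enormD.
  have := xw i; have := xv i i (Aii i); rewrite enormB; have := hd i; lra.
apply: le_trans (enorm_dist (v k i) _ _) _; rewrite (enormB (v k i)).
have := xv i j Aij; have := xv i i (Aii i); lra.
Qed.

(** A window during which little energy is dissipated and the disturbance is
small; [eta] compensates for the weight of the arcs in [small_loss]. *)
Definition quiet sigma k := forall t, (k <= t < k + B)%N ->
  loss t <= eta * sigma ^+ 2 /\ forall i, enorm (d t i) <= sigma.

(** In a quiet window the agents hardly move, so disagreement along an arc
active at any time of the window can be read at its beginning, where the union
of the graphs connects all agents. *)
Lemma quiet_agree sigma k i j : 0 <= sigma -> quiet sigma k ->
  enorm (x k i - x k j) <= n%:R * ((6 * B%:R + 2) * sigma).
Proof.
move=> sigma0 hq.
have move_le m l : (m <= B)%N -> enorm (x (k + m)%N l - x k l) <= m%:R * (3 * sigma).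
  elim: m => [|m IH] mB; first by rewrite addn0 subrr enorm0 mul0r.
  have [h1 h2] := hq (k + m)%N ltac:(lia).
  have [h3 _] := small_loss sigma0 h1 h2.
  rewrite addnS -natr1 mulrDl mul1r [leRHS]addrC.
  by apply: le_trans (enorm_dist (x (k + m)%N l) _ _) _; rewrite lerD // IH // ltnW.
apply: (connect_enorm_le _ _ (A_conn k i j)) => [|a b /hasP[t]].
  by rewrite mulr_ge0 // ltW // ltr_wpDl ?mulr_ge0.
rewrite mem_index_iota => ht; rewrite /edge inE => /andP[_ Aba].
have [h1 h2] := hq t ht.
have [_ h3] := small_loss sigma0 h1 h2.
have := h3 b a; rewrite gt_eqF // => /(_ isT) hab.
pose m := (t - k)%N; have tE : t = (k + m)%N by rewrite /m; lia.
have mB : (m <= B)%N by lia.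
have m_le l : enorm (x t l - x k l) <= B%:R * (3 * sigma).
  rewrite tE; apply: le_trans (move_le m l mB) _.
  by rewrite ler_wpM2r ?mulr_ge0 // ler_nat.
apply: le_trans (enorm_dist (x t a) _ _) _.
apply: le_trans (lerD (lexx _) (enorm_dist (x t b) _ _)) _.
rewrite (enormB (x k a)); have := m_le a; have := m_le b; lra.
Qed.

(** Quiet windows recur within a bounded time [N]: otherwise the energy would
drop by a fixed amount in each window.  At the start of a quiet window all
agents are close to one point [h] of the intersection, and [stay_close] keeps
them there until time [N] has passed. *)
Lemma eventually_consensus (i0 : 'I_n) w : 0 < w ->
  exists K, forall k, (K <= k)%N ->
    exists2 h, HH h & forall i, enorm (x k i - h) <= w.
Proof.
have idx (K1 K2 N k : nat) : (maxn K1 K2 + N <= k)%N ->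
  (K1 <= k - N)%N /\ (K2 <= k - N)%N /\ (N <= k)%N by lia.
move=> w0; have /andP[eta0 eta1] := eta_range.
have w4 : 0 < w / 4 by lra.
have [delta delta0 hdelta] := near_feasible (@H_closed) (ex_intro _ s s_mem) s rho w4.
pose D := Num.min delta (w / 4).
have D0 : 0 < D by rewrite lt_min delta0 w4.
pose C := n%:R * (6 * B%:R + 2) + 1 : R.
have C0 : 0 < C by rewrite ltr_wpDl // mulr_ge0 // addr_ge0 ?mulr_ge0.
pose sigma := D / C.
have sigma0 : 0 < sigma by rewrite divr_gt0.
have Csigma : n%:R * ((6 * B%:R + 2) * sigma) <= D.
  rewrite mulrA /sigma mulrA ler_pdivrMr // mulrC ler_pM2l // /C; lra.
have rho0 : 0 <= rho by exact: le_trans (enorm_ge0 _) (x_bounded 0%N i0).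
pose C2 := n%:R * (2 * rho + 1) : R.
have C20 : 0 <= C2 by rewrite mulr_ge0 // addr_ge0 ?mulr_ge0.
(* With a disturbance below [e1] the energy gained in a window, at most
   [B%:R * (C2 * e1)], is half of what a window that is not quiet dissipates. *)
pose e1 := Num.min (Num.min 1 sigma) (eta * sigma ^+ 2 / (2 * (B%:R * C2 + 1))).
have p1 : 0 < B%:R * C2 + 1 by rewrite ltr_wpDl // mulr_ge0.
have e10 : 0 < e1.
  rewrite !lt_min ltr01 sigma0 /= divr_gt0 //; first by rewrite mulr_gt0 // exprn_gt0.
  by rewrite mulr_gt0.
have e1B : B%:R * (C2 * e1) <= eta * sigma ^+ 2 / 2.
  have : e1 <= eta * sigma ^+ 2 / (2 * (B%:R * C2 + 1)) by rewrite ge_min lexx orbT.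
  rewrite ler_pdivlMr ?mulr_gt0 // => h.
  have := mulr_ge0 (ler0n R B) (mulr_ge0 C20 (ltW e10)); nra.
have [K1 hK1] := d_vanish e10.
have desc k : (K1 <= k)%N -> quiet sigma k \/
    energy (k + B)%N <= energy k - eta * sigma ^+ 2 / 2.
  move=> Kk; case: (pselect (quiet sigma k)) => [|nq]; [by left|right].
  have loss_ge0 t : 0 <= loss t.
    apply: addr_ge0; apply: sumr_ge0 => i _; first exact: sqr_ge0.
    by apply: sumr_ge0 => j _; rewrite mulr_ge0 ?sqr_ge0.
  have step t : (k <= t)%N -> energy t.+1 + loss t <= energy t + C2 * e1.
    move=> kt; apply: energy_step; first by rewrite ltW // !ge_min lexx.
    by move=> i; apply: hK1; exact: leq_trans Kk kt.
  have [t0 ht0 big] : exists2 t, (k <= t < k + B)%N & eta * sigma ^+ 2 < loss t.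
    apply: contrapT => hno; apply: nq => t ht; split.
      by rewrite leNgt; apply/negP => hlt; apply: hno; exists t.
    move=> i; case/andP: ht => kt _; apply: (le_trans (hK1 t i (leq_trans Kk kt))).
    by rewrite !ge_min lexx orbT.
  have tele m : energy (k + m)%N + \sum_(k <= t < k + m) loss t <= energy k + m%:R * (C2 * e1).
    elim: m => [|m IH]; first by rewrite addn0 big_geq // addr0 mul0r addr0.
    rewrite addnS big_nat_recr ?leq_addr //= -natr1 mulrDl mul1r.
    have := step (k + m)%N (leq_addr _ _); lra.
  have : eta * sigma ^+ 2 <= \sum_(k <= t < k + B) loss t.
    apply: le_trans (ltW big) _.
    rewrite (bigD1_seq t0) ?mem_index_iota ?iota_uniq //= lerDl.
    exact: sumr_ge0.
  have := tele B; lra.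
have energy_le k : 0 <= energy k <= n%:R * rho ^+ 2.
  rewrite sumr_ge0 => [/=|i _]; last exact: sqr_ge0.
  rewrite mulr_natl -[X in _ *+ X]card_ord -sumr_const; apply: ler_sum => i _.
  by rewrite lerXn2r ?nnegrE ?enorm_ge0.
have g0 : 0 < eta * sigma ^+ 2 / 2 by rewrite divr_gt0 // mulr_gt0 // exprn_gt0.
have [N hN] := bounded_gain_recurrent g0 energy_le desc.
(* The drift away from [h] during [N] steps is then at most [w / 2]. *)
pose e2 := w / 2 / (N%:R + 1).
have N1 : 0 < N%:R + 1 :> R by rewrite ltr_wpDl.
have e20 : 0 < e2 by rewrite !divr_gt0.
have [K2 hK2] := d_vanish e20.
exists (maxn K1 K2 + N)%N => k Kk.
have [kN1 [kN2 kN]] := idx _ _ _ _ Kk.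
have [m mN hq] := hN (k - N)%N kN1.
have near l : enorm (x (k - N + m)%N i0 - x (k - N + m)%N l) <= D.
  exact: le_trans (quiet_agree i0 l (ltW sigma0) hq) Csigma.
have [|h Hh i0h] := hdelta (x (k - N + m)%N i0) (x_bounded _ _).
  move=> l; exists (x (k - N + m)%N l) => //.
  by apply: le_trans (near l) _; rewrite ge_min lexx.
exists h => // i.
rewrite -[in k](subnK kN) -[X in (_ + X)%N](subnKC mN) addnA; apply: le_trans (stay_close (N - m) (c := w / 2) (e := e2) Hh _ _ i) _.
- by move=> t l ht; apply: hK2; apply: leq_trans kN2 (leq_trans (leq_addr _ _) ht).
- move=> l; apply: le_trans (enorm_dist (x (k - N + m)%N i0) _ _) _.
  rewrite enormB; have := near l; have : D <= w / 4 by rewrite ge_min lexx orbT.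
  move: i0h; lra.
have : (N - m)%:R * e2 <= w / 2.
  rewrite /e2 mulrCA ler_piMr ?ler_pdivrMr ?mul1r //; first lra.
  by rewrite (@le_trans _ _ N%:R) ?ler_nat ?leq_subr // lerDl.
lra.
Qed.

End Consensus.

(** * Gains and scalar sequences *)
Section Scalars.
Context {R : realType}.

(** The derivative [expR c / (1 + expR c ^+ 2)] is at most 1. *)
Lemma atan_expR_lipschitz (a b : R) :
  `|atan (expR a) - atan (expR b)| <= `|a - b|.
Proof.
wlog ab : a b / b <= a => [hw|].
  by case: (leP b a) => [|/ltW] h; [exact: hw|rewrite distrC (distrC a); exact: hw].
have der (x : R) : is_derive x (1 : R) (fun y : R => atan (expR y)) ((1 + expR x ^+ 2)^-1 * expR x).
  exact: is_derive1_comp.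
have [|c _ ->] := MVT_segment ab (fun x _ => der x).
  apply/continuous_subspaceT => y.
  by apply/differentiable_continuous/derivable1_diffP; case: (der y).
rewrite normrM ler_piMl // ger0_norm ?mulr_ge0 ?invr_ge0 ?addr_ge0 ?sqr_ge0 ?expR_ge0 //.
have := expR_ge0 c; move: (expR c) => z z0.
by rewrite mulrC ler_pdivrMr ?ltr_wpDr ?sqr_ge0 // mul1r; nra.
Qed.

Lemma atan_expR_ge (a : R) : 0 <= a -> pi / 4 <= atan (expR a).
Proof. by move=> a0; rewrite -atan1 le_atan // -expR0 ler_expR. Qed.

(** With [u] and [v] the square roots of [p] and [q], the difference of the
inverses is [(v ^+ 2 - u ^+ 2) / (u * v * (u + v))], and [u + v >= u].  Applied
to two gains, this compares the corresponding step sizes. *)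
Lemma inv_sqrt_ratio (p q e : R) : 0 < p -> 0 < q -> `|p - q| <= e * p ->
  `|(Num.sqrt p)^-1 - (Num.sqrt q)^-1| <= e * (Num.sqrt q)^-1.
Proof.
move=> p0 q0; rewrite -{1 2}(sqr_sqrtr (ltW p0)) -{1}(sqr_sqrtr (ltW q0)).
have : 0 < Num.sqrt p by rewrite sqrtr_gt0.
have : 0 < Num.sqrt q by rewrite sqrtr_gt0.
move: (Num.sqrt p) (Num.sqrt q) => u v v0 u0 h.
have -> : u^-1 - v^-1 = (v - u) / u / v. by field; rewrite !gt_eqF.
rewrite 2!normrM !normfV (gtr0_norm u0) (gtr0_norm v0).
rewrite ler_wpM2r ?invr_ge0 ?(ltW v0) // ler_pdivrMr // distrC -(ler_pM2r u0).
have h1 : `|u - v| * u <= `|u - v| * (u + v) by rewrite ler_wpM2l // lerDl ltW.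
apply: le_trans h1 _; apply: le_trans (_ : _ <= e * u ^+ 2) _; last by rewrite -mulrA -expr2.
by move: h; rewrite subr_sqr normrM (ger0_norm (addr_ge0 (ltW u0) (ltW v0))).
Qed.

Lemma linear_growth (D : nat -> R) K delta :
  (forall k, (K <= k)%N -> D k.+1 <= D k + delta) ->
  forall m, D (K + m)%N <= D K + m%:R * delta.
Proof.
move=> hD; elim=> [|m IH]; first by rewrite addn0 mul0r addr0.
by rewrite addnS -natr1 mulrDl mul1r; have := hD _ (leq_addr m K); lra.
Qed.

(** The increments of [Num.sqrt k%:R] are at most [1 / Num.sqrt k.+1%:R], so as
long as [V] stays above [eps] the sum [V k + c * Num.sqrt k%:R] cannot increase,
which is impossible forever.  Below [eps] both alternatives keep [V] there. *)
Lemma eventually_le_of_descent (V : nat -> R) c eps K : 0 < c ->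
  (forall k, 0 <= V k) ->
  (forall k, (K <= k)%N -> V k.+1 <= eps \/
     V k.+1 <= V k - c / Num.sqrt (k.+1%:R)) ->
  exists K', forall k, (K' <= k)%N -> V k <= eps.
Proof.
move=> c0 V0 hV.
have [k0 Kk0 hk0] : exists2 k0, (K <= k0)%N & V k0 <= eps.
  apply: contrapT => none.
  have step m : V (K + m)%N + c * Num.sqrt (K + m)%:R <= V K + c * Num.sqrt K%:R.
    elim: m => [|m IH]; first by rewrite addn0.
    case: (hV (K + m)%N (leq_addr _ _)) => [h|h].
      by case: none; exists (K + m).+1 => //; rewrite -addnS leq_addr.
    rewrite addnS; apply: le_trans IH.
    suff : Num.sqrt (K + m).+1%:R - Num.sqrt (K + m)%:R <=
        (Num.sqrt (K + m).+1%:R)^-1 :> R.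
      by move=> /(ler_wpM2l (ltW c0)); lra.
    have sp : 0 < Num.sqrt (K + m).+1%:R :> R by rewrite sqrtr_gt0 ltr0n.
    rewrite -div1r ler_pdivlMr //.
    have h1 : Num.sqrt (K + m).+1%:R ^+ 2 = (K + m)%:R + 1 :> R.
      by rewrite sqr_sqrtr ?ler0n // natr1.
    have h2 : Num.sqrt (K + m)%:R ^+ 2 = (K + m)%:R :> R by rewrite sqr_sqrtr ?ler0n.
    have h3 : Num.sqrt (K + m)%:R <= Num.sqrt (K + m).+1%:R :> R.
      by rewrite ler_wsqrtr // ler_nat.
    have := sqrtr_ge0 ((K + m)%:R : R); nra.
  pose U := V K + c * Num.sqrt K%:R.
  have U0 : 0 <= U by rewrite addr_ge0 // mulr_ge0 ?sqrtr_ge0 ?ltW.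
  pose m := (Num.truncn ((U / c) ^+ 2)).+1.
  have hm : (U / c) ^+ 2 < m%:R by rewrite truncnS_gt.
  have h4 : U / c < Num.sqrt (K + m)%:R.
    rewrite -[U / c]ger0_norm ?divr_ge0 ?(ltW c0) // -sqrtr_sqr ltr_sqrt.
      by apply: lt_le_trans hm _; rewrite ler_nat leq_addl.
    by rewrite ltr0n addnS.
  rewrite ltr_pdivrMr // mulrC in h4.
  have := step m; have := V0 (K + m)%N; rewrite -/U; lra.
exists k0 => k /subnKC <-; elim: (k - k0)%N => [|m IH]; first by rewrite addn0.
rewrite addnS; case: (hV (k0 + m)%N) => [|//|h]; first exact: leq_trans (leq_addr _ _).
apply: le_trans h _; apply: le_trans _ IH; rewrite gerBl divr_ge0 ?sqrtr_ge0 // ltW //.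
Qed.

End Scalars.

(** * One gradient step *)
Section GradientStep.
Context {R : realType} {r : nat}.
Variable f : 'rV[R]_r -> R.
Hypothesis f_diff : forall s, differentiable f s.
Hypothesis f_convex : @convex_function R 'rV[R]_r [set: 'rV[R]_r] f.
Implicit Types (v s : 'rV[R]_r) (T p : R).

Lemma gradient_step T a v s : 0 <= T -> 0 <= a ->
  enorm (v - T *: (a *: grad f v) - s) ^+ 2 <=
  enorm (v - s) ^+ 2 - 2 * T * a * (f v - f s) + (T * a) ^+ 2 * enorm (grad f v) ^+ 2.
Proof.
move=> T0 a0; rewrite addrAC (enormB_sqr (v - s)) scalerA enormZ exprMn real_normK ?num_real //.
rewrite dotZr dotC lerD2r lerD2l lerN2 -!mulrA ler_pM2l // ler_wpM2l // ler_wpM2l //.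
have := grad_le f_diff f_convex v s; rewrite -[s - v]opprB dotC dotNl [in X in X -> _]dotC; lra.
Qed.

(** This is the purpose of the truncation: a bound on the step that involves
neither [f] nor [v] and tends to [0] as the gain grows. *)
Lemma gr_sqr_le p v : 0 < p -> enorm (gr f p v) ^+ 2 <= (Num.sqrt p)^-1.
Proof.
move=> p0; have sp : 0 < Num.sqrt p by rewrite sqrtr_gt0.
rewrite /gr; case: ifPn => [_|]; last rewrite -ltNge => h; first by rewrite enorm0 expr0n /= invr_ge0 ltW.
rewrite enormZ exprMn real_normK ?num_real // expr2 -mulrA ler_piMr ?invr_ge0 ?(ltW sp) //.
by rewrite mulrC ler_pdivrMr // mul1r ltW.
Qed.

Lemma gr_untruncated p v : enorm (grad f v) ^+ 2 < Num.sqrt p ->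
  gr f p v = (Num.sqrt p)^-1 *: grad f v.
Proof. by move=> h; rewrite /gr leNgt h. Qed.

(** When the step is not truncated, its squared length is at most
[T ^+ 2 / Num.sqrt p], which the decrease of the linear term outweighs. *)
Lemma gr_step_far T p v s : 0 < T -> 0 < p -> T / 2 <= f v - f s ->
  enorm (v - T *: gr f p v - s) <= enorm (v - s).
Proof.
move=> T0 p0 hf; have sp : 0 < Num.sqrt p by rewrite sqrtr_gt0.
case: (leP (Num.sqrt p) (enorm (grad f v) ^+ 2)) => [h|h].
  by rewrite /gr h scaler0 subr0.
rewrite -(@ler_pXn2r _ 2) ?nnegrE ?enorm_ge0 // gr_untruncated //.
have ip : 0 <= (Num.sqrt p)^-1 by rewrite invr_ge0 ltW.
apply: le_trans (gradient_step v s (ltW T0) ip) _.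
have : (T * (Num.sqrt p)^-1) ^+ 2 * enorm (grad f v) ^+ 2 <= T ^+ 2 * (Num.sqrt p)^-1.
  rewrite exprMn -mulrA ler_pM2l ?exprn_gt0 // expr2 -mulrA ler_piMr //.
  by rewrite mulrC ler_pdivrMr // mul1r ltW.
have : T ^+ 2 * (Num.sqrt p)^-1 <= 2 * T * (Num.sqrt p)^-1 * (f v - f s).
  have := ler_wpM2l (mulr_ge0 (ltW T0) ip) hf; nra.
lra.
Qed.

End GradientStep.

(** The errors made when the step [ai] of an agent is replaced by the reference
step [a] and its point [v] by a common point [h]; [fv], [fh], [ft] stand for the
values of its objective at [v], [h] and an optimal point [t].  The coefficients
[4 * T * G * P], [2 * T * G] and [2 * T ^+ 2 * G ^+ 2] come from the difference
of the steps, the distance from [v] to [h], and the square of the step. *)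
Lemma agent_budget (R : realFieldType) (T a ai e G P fv fh ft vt vh g2 : R) :
  0 < T -> 0 < a -> 0 < ai -> 0 < e -> e <= 1 -> 0 <= G ->
  `|ai - a| <= e * a -> ai <= e ->
  fv - ft <= G * vt -> ft - fv <= G * vt -> vt <= 2 * P ->
  fh - fv <= G * vh -> vh <= e -> g2 <= G ^+ 2 ->
  - (2 * T * ai * (fv - ft)) + (T * ai) ^+ 2 * g2 <=
  - (2 * T * a * (fh - ft)) + (4 * T * G * P + 2 * T * G + 2 * T ^+ 2 * G ^+ 2) * e * a.
Proof.
move=> T0 a0 ai0 e0 e1 G0 ar ae L1 L2 vtP L3 vhe gG.
have GP : G * vt <= G * (2 * P) by rewrite ler_wpM2l.
have D : `|fv - ft| <= G * (2 * P) by rewrite ler_norml; apply/andP; split; lra.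
have cross : `|(ai - a) * (fv - ft)| <= e * a * (G * (2 * P)).
  by rewrite normrM ler_pM.
have lin : a * (fh - fv) <= a * (G * e).
  by rewrite ler_pM2l //; apply: le_trans L3 _; rewrite ler_wpM2l.
have ai2 : ai <= 2 * a.
  have : e * a <= 1 * a by rewrite ler_pM2r.
  have := ler_norm (ai - a); lra.
have quad : (T * ai) ^+ 2 * g2 <= T ^+ 2 * (2 * a * e) * G ^+ 2.
  have aa : ai * ai <= 2 * a * e by rewrite ler_pM // ltW.
  apply: (@le_trans _ _ ((T * ai) ^+ 2 * G ^+ 2)); first by rewrite ler_wpM2l ?sqr_ge0.
  by rewrite exprMn ler_wpM2r ?sqr_ge0 // ler_wpM2l ?sqr_ge0 // expr2.
have := ler_norm (- ((ai - a) * (fv - ft))); rewrite normrN => cross'.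
have T2 : 0 <= 2 * T by rewrite mulr_ge0 // ltW.
have := ler_wpM2l T2 (lerD (le_trans cross' cross) lin).
move: quad; move: ((T * ai) ^+ 2 * g2) => S; lra.
Qed.

(** * The distributed projected gradient algorithm *)
Section Algorithm.
Context {R : realType} {n r : nat}.
Variables (f : 'I_n -> 'rV[R]_r -> R) (H : 'I_n -> set 'rV[R]_r).
Variables (A : nat -> 'M[R]_n) (T eta : R) (B : nat).
Variables (x : nat -> 'I_n -> 'rV[R]_r) (q : nat -> 'I_n -> R).
Let HH := \bigcap_(i in [set: 'I_n]) H i.
Let F s := \sum_(i < n) f i s.
Hypothesis f_diff : forall i s, differentiable (f i) s.
Hypothesis f_convex : forall i, @convex_function R 'rV[R]_r [set: 'rV[R]_r] (f i).
Hypothesis f_coercive : forall i c s, exists rho, forall t, f i t <= c -> enorm (t - s) <= rho.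
Hypothesis f_inf : forall i, exists m, forall t, m <= f i t.
Hypothesis H_closed : forall i, closed (H i).
Hypothesis H_convex : forall i, @convex_set R 'rV[R]_r (H i).
Hypothesis H_nonempty : HH !=set0.
Hypothesis A_ge0 : forall k i j, 0 <= A k i j.
Hypothesis A_stoch : forall k, doubly_stochastic (A k).
Hypothesis eta_range : 0 < eta <= 1.
Hypothesis A_diag : forall k i, eta <= A k i i.
Hypothesis A_eta : forall k i j, A k i j != 0 -> eta <= A k i j.
Hypothesis A_conn : forall k, strongly_connected (union_edge A k (k + B)).
Hypothesis T_gt0 : 0 < T.
Hypothesis x_init : forall i, H i (x 0%N i).
Hypothesis q_init : forall i, 0 < q 0%N i.

Let v k i := local_mix (A k) (x k) i.
Let d k i := - (T *: gr (f i) (q k i) (v k i)).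

Hypothesis x_step : forall k i, x k.+1 i = eproj (H i) (v k i + d k i).
Hypothesis q_step : forall k i, q k.+1 i = q k i + atan (expR (enorm (x k i))) * T.

Lemma x_mem k i : H i (x k i).
Proof.
case: k => [|k]; first exact: x_init.
rewrite x_step; apply: eproj_in; first exact: H_closed.
by exists (x 0%N i); exact: x_init.
Qed.

(* On nonnegative reals [atan \o expR] lies between [pi / 4] and [pi / 2], so the
   gains grow at a rate between [c1] and [c2]. *)
Let c1 := pi / 4 * T.
Let c2 := pi / 2 * T.

Let c1_gt0 : 0 < c1. Proof. by rewrite mulr_gt0 // divr_gt0 // pi_gt0. Qed.
Let c2_gt0 : 0 < c2. Proof. by rewrite mulr_gt0 // divr_gt0 // pi_gt0. Qed.

Lemma q_lower k i : q 0%N i + k%:R * c1 <= q k i.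
Proof.
elim: k => [|k IH]; first by rewrite mul0r addr0.
rewrite q_step -natr1 mulrDl mul1r addrA lerD // ler_pM2r //.
exact/atan_expR_ge/enorm_ge0.
Qed.

Lemma q_upper k i : q k i <= q 0%N i + k%:R * c2.
Proof.
elim: k => [|k IH]; first by rewrite mul0r addr0.
rewrite q_step -natr1 mulrDl mul1r addrA lerD // ler_pM2r //.
exact/ltW/atan_ltpi2.
Qed.

Lemma q_ge_time k i : k%:R * c1 <= q k i.
Proof. by apply: le_trans (q_lower k i); rewrite lerDr; apply/ltW/q_init. Qed.

Lemma q_ge_init k i : q 0%N i <= q k i.
Proof. by apply: le_trans (q_lower k i); rewrite lerDl mulr_ge0 // ltW. Qed.

Lemma q_gt0 k i : 0 < q k i.
Proof. exact: lt_le_trans (q_init i) (q_ge_init k i). Qed.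

Lemma q_unbounded c : exists K, forall k i, (K <= k)%N -> c < q k i.
Proof.
exists (Num.truncn (c / c1)).+1 => k i hk; apply: lt_le_trans (q_ge_time k i).
by rewrite -ltr_pdivrMr //; apply: lt_le_trans (truncnS_gt _) _; rewrite ler_nat.
Qed.

Let alpha k i := (Num.sqrt (q k i))^-1.

Lemma alpha_gt0 k i : 0 < alpha k i.
Proof. by rewrite invr_gt0 sqrtr_gt0 q_gt0. Qed.

Lemma alpha_vanish e : 0 < e -> exists K, forall k i, (K <= k)%N -> alpha k i <= e.
Proof.
move=> e0; have [K hK] := q_unbounded ((e^-1) ^+ 2).
exists K => k i /hK h; have := h i; rewrite -ltr_sqrt ?q_gt0 //.
rewrite sqrtr_sqr ger0_norm ?invr_ge0 ?(ltW e0) // => h'.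
by rewrite /alpha invf_ple ?posrE ?sqrtr_gt0 ?q_gt0 // ltW.
Qed.

Lemma d_vanish e : 0 < e -> exists K, forall k i, (K <= k)%N -> enorm (d k i) <= e.
Proof.
move=> e0.
have [|K hK] := @alpha_vanish ((e / T) ^+ 2); first by rewrite exprn_gt0 // divr_gt0.
exists K => k i /hK h; rewrite /d enormN enormZ gtr0_norm // mulrC -ler_pdivlMr //.
rewrite -(@ler_pXn2r _ 2) ?nnegrE ?enorm_ge0 ?divr_ge0 ?(ltW e0) ?(ltW T_gt0) //.
by apply: le_trans (h i); apply: gr_sqr_le; exact: q_gt0.
Qed.

Lemma d_bounded k i : enorm (d k i) <= T * Num.sqrt (alpha 0%N i).
Proof.
rewrite /d enormN enormZ gtr0_norm // ler_pM2l //.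
rewrite -[leLHS]ger0_norm ?enorm_ge0 // -sqrtr_sqr ler_wsqrtr //.
apply: (@le_trans _ _ (alpha k i)); first by apply: gr_sqr_le; exact: q_gt0.
by rewrite lef_pV2 ?posrE ?sqrtr_gt0 ?q_gt0 // ler_wsqrtr // q_ge_init.
Qed.

(** A step from a point where [f i] is large does not increase the distance to
[s]; the other points lie in a fixed ball by coercivity, and the disturbance is
uniformly bounded. *)
Lemma x_bounded s : HH s -> exists rho, forall k i, enorm (x k i - s) <= rho.
Proof.
move=> Hs.
have [rho hrho] := choice (fun i => f_coercive i (f i s + T / 2) s).
pose D := \sum_i (`|rho i| + T * Num.sqrt (alpha 0%N i) + enorm (x 0%N i - s)).
have terms_ge0 i : 0 <= `|rho i| + T * Num.sqrt (alpha 0%N i) + enorm (x 0%N i - s).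
  by rewrite !addr_ge0 ?enorm_ge0 // mulr_ge0 ?sqrtr_ge0 // ltW.
have leD i : `|rho i| + T * Num.sqrt (alpha 0%N i) + enorm (x 0%N i - s) <= D.
  exact: (term_le_sum i terms_ge0).
exists D; elim=> [|k IH] i.
  apply: le_trans (leD i); rewrite lerDr addr_ge0 // mulr_ge0 ?sqrtr_ge0 ?ltW //.
have Hsi : H i s by exact: Hs.
rewrite x_step; apply: le_trans (eproj_le _ (@H_closed i) (@H_convex i) Hsi) _.
case: (leP (f i (v k i)) (f i s + T / 2)) => h.
  rewrite addrAC; apply: le_trans (enormD _ _) _; apply: le_trans (leD i).
  have := hrho i _ h; have := d_bounded k i; have := ler_norm (rho i).
  have := enorm_ge0 (x 0%N i - s).
  move: (enorm _) (enorm _) (enorm _) => a b c; lra.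
apply: le_trans (gr_step_far (@f_diff i) (@f_convex i) T_gt0 (q_gt0 k i) _) _.
  by rewrite lerBrDl ltW.
exact: local_mix_le.
Qed.

Lemma consensus w : 0 < w ->
  exists K, forall k, (K <= k)%N ->
    exists2 h, HH h & forall i, enorm (x k i - h) <= w.
Proof.
move=> w0; have [s Hs] := H_nonempty; have [rho hrho] := x_bounded Hs.
(* Without agents any feasible point will do. *)
case: (pselect (exists i : 'I_n, True)) => [[i0 _]|none]; last first.
  by exists 0%N => k _; exists s => // i; case: none; exists i.
exact: (eventually_consensus H_closed H_convex A_ge0 A_stoch eta_range A_diag
  A_eta A_conn x_step x_mem Hs hrho d_vanish i0 w0).
Qed.

(** After consensus the increments of the gains of two agents differ by at most
[2 * w * T], so the gains themselves differ by little compared with their linear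
growth [k%:R * c1]. *)
Lemma alpha_ratio e : 0 < e -> exists K, forall k i j, (K <= k)%N ->
  `|alpha k i - alpha k j| <= e * alpha k j.
Proof.
move=> e0.
pose w := e * c1 / (4 * T).
have ec0 : 0 < e * c1 by rewrite mulr_gt0.
have w0 : 0 < w by rewrite divr_gt0 // mulr_gt0.
have [K0 hK0] := consensus w0.
pose Q := \sum_l q K0 l.
have Q0 : 0 <= Q by apply: sumr_ge0 => l _; rewrite ltW ?q_gt0.
(* The difference of two gains accumulated up to time [K0] is at most [2 * Q]; it
   takes [m0] further steps to make it negligible. *)
pose m0 := (Num.truncn (2 * (2 * Q) / (e * c1))).+1.
have hm0 : 2 * (2 * Q) / (e * c1) < m0%:R by rewrite truncnS_gt.
exists (K0 + m0)%N => k i j hk.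
apply: inv_sqrt_ratio; rewrite ?q_gt0 //.
have step t : (K0 <= t)%N -> `|q t.+1 i - q t.+1 j| <= `|q t i - q t j| + 2 * w * T.
  move=> /hK0[h _ hh]; rewrite !q_step opprD addrACA.
  apply: le_trans (ler_normD _ _) _; rewrite lerD2l -mulrBl normrM (gtr0_norm T_gt0) ler_pM2r //.
  apply: le_trans (atan_expR_lipschitz _ _) _.
  have e1 := enorm_dist h (x t i) (0 : 'rV[R]_r).
  have l (a b : 'I_n) : enorm (x t a) - enorm (x t b) <= 2 * w.
    have := enormD (x t a - x t b) (x t b); rewrite subrK.
    have := enorm_dist h (x t a) (x t b); rewrite (enormB h).
    have := hh a; have := hh b; lra.
  by rewrite ler_norml lerNl opprB !l.
have [m kE] : exists m, k = (K0 + m)%N by exists (k - K0)%N; rewrite subnKC // (leq_trans (leq_addr m0 K0)).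
have m0m : (m0 <= m)%N by rewrite -(leq_add2l K0) -kE.
have := linear_growth step m; rewrite -kE => hD.
have hQ : `|q K0 i - q K0 j| <= 2 * Q.
  have hi l : 0 <= q K0 l <= Q by rewrite ltW ?q_gt0 // (term_le_sum l (fun l => ltW (q_gt0 K0 l))).
  have /andP[_ a1] := hi i; have /andP[_ a2] := hi j.
  apply: le_trans (ler_normB _ _) _; rewrite !gtr0_norm ?q_gt0 //; lra.
apply: le_trans hD _; apply: (@le_trans _ _ (e * (k%:R * c1))); last by rewrite ler_pM2l // q_ge_time.
have hm : 2 * (2 * Q) <= m%:R * (e * c1).
  by rewrite -ler_pdivrMr //; apply: le_trans (ltW hm0) _; rewrite ler_nat.
have hw : 2 * w * T = e * c1 / 2 by rewrite /w; field; rewrite gt_eqF.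
have hk' : m%:R * (e * c1) <= e * (k%:R * c1).
  by rewrite mulrCA ler_pM2l // ler_pM2r // ler_nat kE leq_addl.
rewrite hw; lra.
Qed.

Lemma objective_continuous : continuous F.
Proof.
apply: continuous_big => [|i _]; first exact: add_continuous.
exact: (everywhere_differentiable_continuous (@f_diff i)).
Qed.

Lemma objective_coercive (i0 : 'I_n) c s :
  exists rho, forall t, F t <= c -> enorm (t - s) <= rho.
Proof.
have [m hm] := choice f_inf.
have [rho hrho] := f_coercive i0 (c - \sum_(i | i != i0) m i) s.
exists rho => t Ft; apply: hrho; rewrite lerBrDr; apply: le_trans Ft.
by rewrite /F [leRHS](bigD1 i0) //= lerD2l; apply: ler_sum => i _.
Qed.

Let X := optimal_set f H.
Let HH_closed : closed HH. Proof. exact: feasible_closed. Qed.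

Lemma optimal_nonempty (i0 : 'I_n) : X !=set0.
Proof.
have [s Hs] := H_nonempty; have [rho hrho] := objective_coercive i0 (F s) s.
apply: (minimizers_nonempty objective_continuous HH_closed Hs (s := s) (rho := rho)).
by move=> t _; exact: hrho.
Qed.

Lemma optimal_closed : closed X.
Proof.
case: (pselect (X !=set0)) => [[z [Hz zmin]]|]; last first.
  by move=> /set0P/negP; rewrite negbK => /eqP ->; exact: closed0.
rewrite (_ : X = HH `&` [set t | F t <= F z]); last first.
  apply/seteqP; split=> [t [Ht tmin]|t [Ht /= tz]]; first by split=> //; exact: tmin.
  by split=> // y Hy; apply: le_trans tz _; exact: zmin.
by apply: closedI => //; exact: closed_sublevel objective_continuous.
Qed.

(** A strict form of optimality, again by compactness: feasible points away from
the optimal set have a value above the optimum by a fixed amount. *)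
Lemma optimality_gap s rho z e : X z -> 0 < e ->
  exists2 mu, 0 < mu & forall h, HH h -> enorm (h - s) <= rho ->
    e <= enorm (h - eproj X h) -> mu <= F h - F z.
Proof.
move=> Xz e0; have [Hz zmin] := Xz.
pose C := (HH `&` [set t : 'rV[R]_r | enorm (s - t) <= rho]) `&`
          [set t | e <= enorm (t - eproj X t)].
have cX := optimal_closed.
have [||||mu mu0 hmu] := @positive_on_compact R r (fun t => F t - F z) C s rho.
- move=> t; apply: (@cvgB _ _ _ (nbhs t) _ F (cst (F z))); last exact: cvg_cst.
  exact: objective_continuous.
- apply: closedI; last first.
    by apply: closed_superlevel; apply: eproj_dist_continuous => //; exists z.
  by apply: closedI => //; exact/closed_sublevel/enorm_dist_continuous.
- by move=> t [[_ /= h] _]; rewrite enormB.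
- move=> t [[Ht _] /= he]; rewrite subr_gt0 ltNge; apply/negP => tz.
  have Xt : X t by split=> // y Hy; apply: le_trans tz _; exact: zmin.
  have := eproj_min t cX Xt; rewrite subrr enorm0; lra.
by exists mu => // h Hh hs he; apply: hmu; split=> //; split=> //=; rewrite enormB.
Qed.

(** The lower bound makes the sum of the step sizes diverge. *)
Lemma alpha_lower i : exists2 c, 0 < c &
  forall k, c / Num.sqrt k.+1%:R <= alpha k i.
Proof.
have p0 : 0 < q 0%N i + c2 by rewrite addr_gt0.
exists (Num.sqrt (q 0%N i + c2))^-1; first by rewrite invr_gt0 sqrtr_gt0.
move=> k; rewrite -invfM -sqrtrM ?(ltW p0) // /alpha.
have k0 : 0 < k.+1%:R :> R by rewrite ltr0n.
rewrite lef_pV2 ?posrE ?sqrtr_gt0 ?q_gt0 ?mulr_gt0 // ler_wsqrtr //.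
apply: le_trans (q_upper k i) _; rewrite -natr1.
have aux (a b y : R) : 0 <= a -> 0 <= b -> 0 <= y -> a + y * b <= (a + b) * (y + 1).
  by move=> a0 b0 y0; have := mulr_ge0 a0 y0; lra.
by apply: aux; rewrite ?ler0n // ltW.
Qed.

(** For the step size of one agent taken as a reference, the agents together
perform an approximate gradient step for [F] at a feasible point [h].  The error
[w] multiplies the step size, and the estimate is uniform in the optimal point
[t], as is needed when [t] follows the moving average. *)
Lemma descent (i0 : 'I_n) w : 0 < w ->
  exists K, forall k, (K <= k)%N -> exists h, [/\ HH h,
    forall i, enorm (x k i - h) <= w &
    forall t, X t -> \sum_i enorm (x k.+1 i - t) ^+ 2 <=
      \sum_i enorm (x k i - t) ^+ 2 - alpha k i0 * (2 * T * (F h - F t) - w)].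
Proof.
move=> w0.
have [s Hs] := H_nonempty; have [rho hrho] := x_bounded Hs.
have [z [Hz zmin]] := optimal_nonempty i0.
have [rhoX hrhoX] := objective_coercive i0 (F z) s.
pose P := `|rho| + `|rhoX| + 1.
have gb i : exists G, forall t, enorm (t - s) <= P -> enorm (grad (f i) t) <= G.
  by have [G _ hG] := grad_bounded (@f_diff i) (@f_convex i) s P; exists G.
have [Gf hGf] := choice gb.
pose G := \sum_i `|Gf i|.
have G0 : 0 <= G by apply: sumr_ge0 => i _.
have hG i t : enorm (t - s) <= P -> enorm (grad (f i) t) <= G.
  move=> ht; apply: le_trans (hGf i t ht) _; apply: le_trans (ler_norm _) _.
  exact: (term_le_sum i (fun j => normr_ge0 (Gf j))).
have P0 : 0 <= P by rewrite !addr_ge0.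
pose C := 4 * T * G * P + 2 * T * G + 2 * T ^+ 2 * G ^+ 2.
have C0 : 0 <= C.
  by rewrite /C !addr_ge0 // !mulr_ge0 ?exprn_ge0 // ltW.
(* [C] is the coefficient in [agent_budget].  The tolerance [e] serves at once for
   the distances to [h], the relative differences of the step sizes and the step
   sizes themselves; the [n] agents contribute a total error of at most
   [n%:R * (C * e)]. *)
pose e := Num.min (Num.min w 1) (w / (n%:R * C + 1)).
have nC : 0 < n%:R * C + 1 by rewrite ltr_wpDl // mulr_ge0.
have e0 : 0 < e by rewrite !lt_min w0 ltr01 divr_gt0.
have [ew e1 eC] : [/\ e <= w, e <= 1 & n%:R * (C * e) <= w].
  split; [by rewrite !ge_min lexx|by rewrite !ge_min lexx orbT|].
  have : e <= w / (n%:R * C + 1) by rewrite ge_min lexx orbT.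
  rewrite ler_pdivlMr //; have := mulr_ge0 (ler0n R n) (mulr_ge0 C0 (ltW e0)); lra.
have [K1 hK1] := consensus e0.
have [K2 hK2] := alpha_ratio e0.
have [K3 hK3] := alpha_vanish e0.
have [K4 hK4] := q_unbounded ((G ^+ 2) ^+ 2).
exists (maxn (maxn K1 K2) (maxn K3 K4)) => k.
rewrite !geq_max => /andP[/andP[/hK1[h Hh hxh] hk2] /andP[hk3 hk4]].
exists h; split=> // [i|t Xt]; first exact: le_trans (hxh i) ew.
have [Ht tmin] := Xt.
have rho_P : rho + 1 <= P by rewrite /P; have := ler_norm rho; have := normr_ge0 rhoX; lra.
have hs : enorm (h - s) <= P.
  apply: le_trans (enorm_dist (x k i0) _ _) _; rewrite enormB.
  have := hxh i0; have := hrho k i0; lra.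
have ts : enorm (t - s) <= P.
  apply: le_trans (hrhoX t _) _; first exact: tmin.
  by rewrite /P; have := ler_norm rhoX; have := normr_ge0 rho; lra.
set a := alpha k i0; have a0 : 0 < a by exact: alpha_gt0.
have per_agent i : enorm (x k.+1 i - t) ^+ 2 <=
    enorm (v k i - t) ^+ 2 + (- (2 * T * a * (f i h - f i t)) + C * e * a).
  have Hti : H i t by exact: Ht.
  have vs : enorm (v k i - s) <= P by apply: le_trans (local_mix_le _ _ _ (hrho k)) _ => //; lra.
  have vh : enorm (v k i - h) <= e by exact: local_mix_le.
  have sq : enorm (grad (f i) (v k i)) ^+ 2 < Num.sqrt (q k i).
    apply: (@le_lt_trans _ _ (G ^+ 2)).
      by rewrite lerXn2r ?nnegrE ?enorm_ge0 // hG.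
    by rewrite -[G ^+ 2]ger0_norm ?exprn_ge0 // -sqrtr_sqr ltr_sqrt ?q_gt0 // hK4.
  have step1 : enorm (x k.+1 i - t) ^+ 2 <= enorm (v k i + d k i - t) ^+ 2.
    rewrite lerXn2r ?nnegrE ?enorm_ge0 // x_step.
    exact: (eproj_le _ (@H_closed i) (@H_convex i) Hti).
  have ai0 := alpha_gt0 k i.
  have step2 := gradient_step (@f_diff i) (@f_convex i) (v k i) t (ltW T_gt0) (ltW ai0).
  apply: le_trans step1 _; rewrite /d gr_untruncated //.
  apply: le_trans step2 _; rewrite -addrA lerD2l.
  have g2 : enorm (grad (f i) (v k i)) ^+ 2 <= G ^+ 2.
    by rewrite lerXn2r ?nnegrE ?enorm_ge0 // hG.
  have vt : enorm (v k i - t) <= 2 * P.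
    apply: le_trans (enorm_dist s _ _) _; rewrite (enormB s); lra.
  have L1 := lipschitz_of_grad (@f_diff i) (@f_convex i) t (hG i _ vs).
  have L2 := lipschitz_of_grad (@f_diff i) (@f_convex i) (v k i) (hG i _ ts).
  have L3 := lipschitz_of_grad (@f_diff i) (@f_convex i) (v k i) (hG i _ hs).
  rewrite (enormB t) in L2; rewrite (enormB h) in L3.
  have ar := hK2 k i i0 hk2; have av := hK3 k i hk3.
  rewrite -/a in ar.
  exact: agent_budget L1 L2 vt L3 vh g2.
apply: le_trans (ler_sum _ (fun i _ => per_agent i)) _.
rewrite big_split /= big_split /= sumr_const card_ord.
have mix : \sum_i enorm (v k i - t) ^+ 2 <= \sum_i enorm (x k i - t) ^+ 2.
  rewrite -(sum_local_mix (x k) t (A_ge0 k) (A_stoch k)) lerDl.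
  by apply: sumr_ge0 => i _; apply: sumr_ge0 => j _; rewrite mulr_ge0 ?sqr_ge0.
apply: lerD mix _; rewrite sumrN -mulr_sumr sumrB -/(F h) -/(F t) -mulr_natl.
have := ler_wpM2l (ltW a0) eC; lra.
Qed.

(** By the variance identity, minimizing the sum of squared distances over [t]
amounts to minimizing the distance to the average. *)
Lemma closest_to_average (y : 'I_n -> 'rV[R]_r) t : X t -> (0 < n)%N ->
  \sum_i enorm (y i - eproj X (average y)) ^+ 2 <= \sum_i enorm (y i - t) ^+ 2.
Proof.
move=> Xt n0; pose p (i : 'I_n) : R := n%:R^-1.
have nn : n%:R != 0 :> R by rewrite pnatr_eq0 -lt0n.
have p1 : \sum_i p i = 1 by rewrite sumr_const card_ord -(mulr_natl (n%:R^-1)) mulfV.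
have avgE : average y = \sum_i p i *: y i by rewrite /average scaler_sumr.
have vi s := variance_identity y s p1.
have sumE s : \sum_i enorm (y i - s) ^+ 2 = n%:R * \sum_i p i * enorm (y i - s) ^+ 2.
  by rewrite -mulr_sumr mulrA mulfV // mul1r.
have := eproj_min (average y) optimal_closed Xt.
move: (eproj X (average y)) => z; rewrite avgE => hz.
rewrite (sumE z) (sumE t) ler_pM2l ?ltr0n // (vi z) (vi t) lerD2r.
by rewrite lerXn2r ?nnegrE ?enorm_ge0.
Qed.

(** Far from the optimal set [descent] and [optimality_gap] make the sum decrease
by a multiple of the step size.  Near it, the sum is small at time [k] when
measured from the projection of [h], and by [closest_to_average] it is not
larger at time [k.+1] when measured from the projection of the average. *)
Lemma distance_to_optimal_vanish (i0 : 'I_n) eps : 0 < eps ->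
  exists K, forall k, (K <= k)%N ->
    \sum_i enorm (x k i - eproj X (average (x k))) ^+ 2 <= eps.
Proof.
move=> eps0.
have n0 : (0 < n)%N by case: n i0 => // -[].
have [s Hs] := H_nonempty; have [rho hrho] := x_bounded Hs.
have X0 := optimal_nonempty i0; have [z Xz] := X0; have [Hz zmin] := Xz.
have cX := optimal_closed.
(* When all agents are within [2 * e] of an optimal point, the sum is at most
   [n%:R * (2 * e) ^+ 2], and one more step adds at most [e]. *)
pose e := Num.min 1 (eps / (4 * n%:R + 1)).
have p0 : 0 < 4 * n%:R + 1 :> R by rewrite ltr_wpDl // mulr_ge0.
have e0 : 0 < e by rewrite lt_min ltr01 divr_gt0.
have e1 : e <= 1 by rewrite ge_min lexx.
have ee : (4 * n%:R + 1) * e <= eps.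
  have : e <= eps / (4 * n%:R + 1) by rewrite ge_min lexx orbT.
  by rewrite ler_pdivlMr // mulrC.
have [mu mu0 hmu] := optimality_gap s (rho + 1) Xz e0.
pose w := Num.min e (T * mu).
have w0 : 0 < w by rewrite lt_min e0 mulr_gt0.
have we : w <= e by rewrite ge_min lexx.
have wmu : w <= T * mu by rewrite ge_min lexx orbT.
have [K1 hK1] := descent i0 w0.
have [K2 hK2] := alpha_vanish ltr01.
have [c c0 hc] := alpha_lower i0.
pose V k := \sum_i enorm (x k i - eproj X (average (x k))) ^+ 2.
have V0 k : 0 <= V k by apply: sumr_ge0 => i _; exact: sqr_ge0.
apply: (@eventually_le_of_descent _ V (c * (T * mu)) eps (maxn K1 K2)) => //.
  by rewrite !mulr_gt0.
move=> k; rewrite geq_max => /andP[/hK1[h [Hh hxh hdesc]] /(hK2 k i0) a1].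
have a0 := alpha_gt0 k i0.
case: (leP e (enorm (h - eproj X h))) => hX; [right|left].
  have hs : enorm (h - s) <= rho + 1.
    apply: le_trans (enorm_dist (x k i0) _ _) _; rewrite enormB.
    have := hxh i0; have := hrho k i0; lra.
  have gap := hmu _ Hh hs hX.
  have Xs := eproj_in (average (x k)) cX X0.
  apply: le_trans (closest_to_average (x k.+1) Xs n0) _.
  apply: le_trans (hdesc _ Xs) _; rewrite lerD2l lerN2.
  have -> : F (eproj X (average (x k))) = F z.
    by apply: le_anti; rewrite zmin ?andbT; case: Xs => // ? ; apply.
  rewrite mulrAC ler_pM ?divr_ge0 ?sqrtr_ge0 ?(ltW c0) ?mulr_ge0 ?(ltW T_gt0) ?(ltW mu0) //.
  have := ler_wpM2l (ltW T_gt0) gap; lra.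
have Xh := eproj_in h cX X0.
apply: le_trans (closest_to_average (x k.+1) Xh n0) _.
apply: le_trans (hdesc _ Xh) _.
have Fh : 0 <= F h - F (eproj X h) by rewrite subr_ge0; case: Xh => _; apply.
have sum_le : \sum_i enorm (x k i - eproj X h) ^+ 2 <= n%:R * (2 * e) ^+ 2.
  rewrite mulr_natl -[X in _ *+ X]card_ord -sumr_const; apply: ler_sum => i _.
  rewrite lerXn2r ?nnegrE ?enorm_ge0 ?mulr_ge0 ?(ltW e0) //.
  apply: le_trans (enorm_dist h _ _) _; have := hxh i; lra.
have ee2 : e ^+ 2 <= e by rewrite expr2 ler_piMl // ltW.
have nee := ler_wpM2l (ler0n R n) ee2.
have aw : alpha k i0 * w <= e.
  by apply: le_trans we; rewrite ler_piMl // ltW.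
have aF : 0 <= alpha k i0 * (2 * T * (F h - F (eproj X h))).
  by rewrite !mulr_ge0 // ltW.
move: sum_le aF; rewrite mulrBr; lra.
Qed.

End Algorithm.

Theorem theorem4 (R : realType) (n r : nat)
  (f : 'I_n -> 'rV[R]_r -> R) (H : 'I_n -> set 'rV[R]_r)
  (A : nat -> 'M[R]_n) (T : R) (gamma : 'I_n -> R)
  (x : nat -> 'I_n -> 'rV[R]_r) (q : nat -> 'I_n -> R)
  (f_diff : forall (i : 'I_n) (s : 'rV[R]_r), differentiable (f i) s)
  (f_convex : forall i : 'I_n,
     @convex_function R 'rV[R]_r [set: 'rV[R]_r] (f i))
  (H_closed : forall i : 'I_n, closed (H i))
  (H_convex : forall i : 'I_n, @convex_set R 'rV[R]_r (H i))
  (A_ge0 : forall (k : nat) (i j : 'I_n), 0 <= A k i j)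
  (T_gt0 : 0 < T)
  (gamma_range : forall i : 'I_n, 0 < gamma i <= 1)
  (hyp_i : forall i : 'I_n,
     [set s | grad (f i) s = 0] !=set0 /\
     bounded_set [set s | grad (f i) s = 0])
  (hyp_ii : \bigcap_(i in [set: 'I_n]) H i !=set0)
  (hyp_iii : exists eta : R, 0 < eta <= 1 /\
     forall k : nat,
       (forall i : 'I_n, eta <= A k i i) /\
       (forall i j : 'I_n, A k i j != 0 -> eta <= A k i j) /\
       doubly_stochastic (A k))
  (hyp_iv : exists (M : nat) (kappa : nat -> nat),
     (0 < M)%N /\ kappa 0%N = 0%N /\
     forall j : nat,
       (0 < kappa j.+1 - kappa j <= M)%N /\
       strongly_connected (union_edge A (kappa j) (kappa j.+1)))
  (gamma_eq1 : forall i : 'I_n, gamma i = 1)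
  (x_init : forall i : 'I_n, H i (x 0%N i))
  (q_init : forall i : 'I_n, 0 < q 0%N i)
  (x_q_alg : algorithm T gamma f H A x q) :
  (forall i : 'I_n,
     (fun k : nat => x k i - average (x k)) @ \oo --> (0 : 'rV[R]_r)) /\
  (forall i : 'I_n,
     (fun k : nat => enorm (x k i - eproj (optimal_set f H) (average (x k))))
       @ \oo --> (0 : R)) /\
  (forall (i : 'I_n) (k : nat), H i (x k i)).
Proof.
have [eta [eta_range A_hyp]] := hyp_iii.
have [M [kappa [_ [kappa0 kappa_hyp]]]] := hyp_iv.
have A_diag k i : eta <= A k i i by have [] := A_hyp k.
have A_eta k i j : A k i j != 0 -> eta <= A k i j by have [_ []] := A_hyp k => + _; apply.
have A_stoch k : doubly_stochastic (A k) by have [_ []] := A_hyp k.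
have A_conn := windows_connected kappa0 kappa_hyp.
have f_coercive i := convex_coercive (@f_diff i) (@f_convex i) (hyp_i i).1 (hyp_i i).2.
have f_inf i : exists m, forall t, m <= f i t.
  have [[z /= z0] _] := hyp_i i; exists (f i z) => t.
  have := grad_le (@f_diff i) (@f_convex i) z t.
  by rewrite z0 dot0l subr_ge0.
have x_step k i : x k.+1 i =
    eproj (H i) (local_mix (A k) (x k) i - T *: gr (f i) (q k i) (local_mix (A k) (x k) i)).
  have [-> _] := x_q_alg k i.
  by rewrite /control gamma_eq1 subrr scale0r add0r scale1r.
have q_step k i : q k.+1 i = q k i + atan (expR (enorm (x k i))) * T.
  by have [] := x_q_alg k i.
have x_in := x_mem H_closed x_init x_step.
have cons := consensus f_diff f_convex f_coercive H_closed H_convex hyp_ii A_ge0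
  A_stoch eta_range A_diag A_eta A_conn T_gt0 x_init q_init x_step q_step.
have opt := distance_to_optimal_vanish f_diff f_convex f_coercive f_inf H_closed
  H_convex hyp_ii A_ge0 A_stoch eta_range A_diag A_eta A_conn T_gt0 x_init q_init
  x_step q_step.
split=> [i|]; last split=> // i.
- have n0 : (0 < n)%N by exact: leq_ltn_trans (leq0n i) (ltn_ord i).
  apply/norm_cvg0P/cvgrPdist_le => e e0.
  have [|K hK] := cons (e / 2); first by rewrite divr_gt0.
  exists K => // k /= /hK[h _ hxh].
  rewrite sub0r normrN ger0_norm //; apply: le_trans (norm_le_enorm _) _.
  apply: le_trans (enorm_dist h _ _) _.
  have avg_h : enorm (average (x k) - h) <= e / 2.
    rewrite /average scaler_sumr; apply: enorm_mean_le => //.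
    by rewrite sumr_const card_ord -(mulr_natl (n%:R^-1)) mulfV // pnatr_eq0 -lt0n.
  by rewrite (enormB h); have := hxh i; lra.
- apply/cvgrPdist_le => e e0.
  have [|K hK] := opt i (e ^+ 2); first by rewrite exprn_gt0.
  exists K => // k /= /hK h.
  rewrite sub0r normrN ger0_norm ?enorm_ge0 // -(@ler_pXn2r _ 2) ?nnegrE ?enorm_ge0 ?(ltW e0) //.
  apply: le_trans h.
  exact: (term_le_sum i (fun j => sqr_ge0 (enorm (x k j - eproj (optimal_set f H) (average (x k)))))).
Qed.
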